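(* Let $A',B'\in\mathcal B(T)$ with $A'\cap B'=\varnothing$, and let $f_1,\dots,f_m,f_{m+1},\dots,f_{m+k},g_1,\dots,g_n\in B_0(T)$ be such that $\operatorname{supp}f_i\subset A'$ for $i=1,\dots,m+k$ and $\operatorname{supp}g_j\subset B'$ for $j=1,\dots,n$. Then $$\tau\big(\langle f_1,\xi\rangle\dotsm\langle f_m,\xi\rangle\langle g_1,\xi\rangle\dotsm\langle g_n,\xi\rangle\langle f_{m+1},\xi\rangle\dotsm\langle f_{m+k},\xi\rangle\big)$$ $$=\tau\big(\langle f_1,\xi\rangle\dotsm\langle f_m,\xi\rangle\langle f_{m+1},\xi\rangle\dotsm\langle f_{m+k},\xi\rangle\big)\,\tau\big(\langle g_1,\xi\rangle\dotsm\langle g_n,\xi\rangle\big).$$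
   Context: $T$ is a locally compact Polish space with Borel $\sigma$-algebra $\mathcal B(T)$; $\sigma$ is a Radon non-atomic measure on $T$. $A\in\mathcal B(T^2)$ is a symmetric set containing the diagonal, with $\sigma^{\otimes2}(A)=0$; $Q:T^2\setminus A\to\{z\in\mathbb C:|z|=1\}$ is measurable with $Q(s,t)=\overline{Q(t,s)}$. $B_0(T)$: real-valued bounded Borel functions on $T$ with compact support. $\nu$ is a probability measure on $\mathbb R$ with $\int_{\mathbb R}e^{\varepsilon|x|}\nu(dx)<\infty$ for some $\varepsilon>0$; $\mu_k(x):=x^k$. Extend $Q$ by $Q(t_1,x_1,t_2,x_2):=Q(t_1,t_2)$, $x_1,x_2\in\mathbb R$. $\mathcal G:=L^2(T\times\mathbb R,\sigma\otimes\nu)$ with complexification $\mathcal G_{\mathbb C}$. On $\mathcal G_{\mathbb C}^{\otimes n}=L^2((T\times\mathbb R)^n\to\mathbb C,(\sigma\otimes\nu)^{\otimes n})$ let $(\Psi_jF)(t_1,x_1,\dots,t_n,x_n)$ be $Q(t_j,t_{j+1})$ times $F$ with $(t_j,x_j)$ and $(t_{j+1},x_{j+1})$ interchanged; these extend to a unitary representation $\pi\mapsto\Psi_\pi$ of $S_n$ with $\Psi_{(j,j+1)}=\Psi_j$; $P_n:=\frac1{n!}\sum_{\pi\in S_n}\Psi_\pi$, $\mathcal G_{\mathbb C}^{\circledast n}:=P_n\mathcal G_{\mathbb C}^{\otimes n}$, $\mathcal G_{\mathbb C}^{\circledast0}:=\mathbb C$. $\mathcal F^Q(\mathcal G):=\bigoplus_{n\ge0}\mathcal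 G_{\mathbb C}^{\circledast n}n!$ (so $\|F\|^2=\sum_nn!\|F^{(n)}\|^2$), $\Omega:=(1,0,0,\dots)$. $\mathfrak D\subset\mathcal F^Q(\mathcal G)$ consists of all finite sequences $(F^{(0)},\dots,F^{(n)},0,0,\dots)$ with each $F^{(k)}$, $k\ge1$, of the form $P_k\big[\sum_{(i_1,\dots,i_k)\in\{0,\dots,N\}^k}f_{(i_1,\dots,i_k)}(t_1,\dots,t_k)x_1^{i_1}\dotsm x_k^{i_k}\big]$, $f_{(i_1,\dots,i_k)}\in L^2(T^k\to\mathbb C,\sigma^{\otimes k})$, $N\in\mathbb N$. For $f\in B_0(T)$, the operator $\langle f,\xi\rangle:\mathfrak D\to\mathfrak D$ is $$\langle f,\xi\rangle:=a^+(f\otimes\mu_0)+a^0(f\otimes\mu_1)+a^-(f\otimes\mu_0),$$ where for $F^{(k)}\in\mathcal G_{\mathbb C}^{\circledast k}$: $a^+(h)F^{(k)}:=P_{k+1}(h\otimes F^{(k)})$; $a^-(h)$ is the adjoint of $a^+(h)$ (restricted to $\mathfrak D$); $a^0(h)F^{(k)}$ is $F^{(k)}$ multiplied by $h(t_1,x_1)+\dots+h(t_k,x_k)$. The vacuum state is $\tau(p):=(p\Omega,\Omega)_{\mathcal F^Q(\mathcal G)}$. *)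

(* Defs.v *)
From HB Require Import structures.
From mathcomp Require Import all_boot all_order all_algebra all_fingroup.
From mathcomp Require Import all_classical all_reals all_analysis.
From mathcomp Require Import complex zify.

Set Implicit Arguments.
Unset Strict Implicit.
Unset Printing Implicit Defensive.

Import Order.TTheory GRing.Theory Num.Theory.
Import numFieldNormedType.Exports.

Local Open Scope classical_set_scope.
Local Open Scope ring_scope.

Notation borel T := (g_sigma_algebraType (@open T)).
Notation phase T R := (borel T * R)%type (only parsing).

Section topology.
Context (R : realType) (T : ptopologicalType).

Definition complete_metric (dist : T -> T -> R) :=
  [/\ forall x y, dist x y = 0 <-> x = y,
      forall x y, dist x y = dist y x,
      forall x y z, dist x z <= dist x y + dist y z,
      forall x (U : set T),
        nbhs x U <-> exists2 e : R, 0 < e & [set y | dist x y < e] `<=` U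
    & forall u : nat -> T,
        (forall e : R, 0 < e -> exists N, forall i j, (N <= i)%N -> (N <= j)%N ->
          dist (u i) (u j) < e) ->
        exists l : T, u @ \oo --> l].

Definition polish :=
  (exists2 D : set T, countable D & dense D) /\
  (exists dist, complete_metric dist).

Implicit Type s : {measure set (borel T) -> \bar R}.

Definition radon s :=
  (forall K, compact (K : set T) -> (s K < +oo)%E) /\
  (forall B, measurable B ->
    s B = ereal_sup [set s K | K in [set K | compact (K : set T) /\ K `<=` B]]).

Definition nonatomic s :=
  forall B, measurable B -> (0 < s B)%E ->
  exists C, [/\ measurable C, C `<=` B, (0 < s C)%E & (s C < s B)%E].

Definition supp (f : T -> R) : set T := closure [set t | f t != 0].

Definition B0 (f : T -> R) :=
  [/\ measurable_fun setT (f : borel T -> R),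
      exists M, forall t, `|f t| <= M
    & compact (supp f)].

Lemma radon_sigma_finite s :
  polish -> locally_compact [set: T] -> radon s -> sigma_finite setT s.
Proof.
move=> [[D cD dD] [dist [dist0 distC distD nbhsE _]]] lcT [rK _].
have distxx x : dist x x = 0 by exact/dist0.
pose B a (e : R) : set (borel T) := [set y | dist a y < e].
have oB x e : open (B x e).
  rewrite openE => y /= xy; apply/nbhsE; exists (e - dist x y).
    by rewrite subr_gt0.
  by move=> z /= yz; rewrite /B/= (le_lt_trans (distD x y z))// -ltrBrDl.
have mB x e : measurable (B x e : set (borel T)).
  by apply: sub_sigma_algebra; exact: oB.
have [e eD] : exists e : nat -> T, D `<=` range e.
  move/pfcard_geP : cD => [->|[e]]; first by exists (fun=> point).
  exists e => x Dx; have [n _ <-] := @surj _ _ _ _ e x Dx.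
  by exists n.
pose b p := B (e p.1) (p.2.+1%:R^-1 : R).
pose F n : set (borel T) :=
  if @unpickle (nat * nat)%type n is Some p then
    if (s (b p) < +oo)%E then b p else set0
  else set0.
exists F; last first.
  move=> n; rewrite /F; have s0 : measurable (set0 : set (borel T)) /\ (s set0 < +oo)%E.
    by split => //; rewrite measure0 ltry.
  by case: unpickle => [p|//]; case: ifPn => // soo; split => //; exact: mB.
apply/esym/seteqP; split=> // x _.
have [U] := lcT x I; rewrite /within/= => xU [Uc clU].
have {xU}/nbhsE[r r0 xrU] : nbhs x U.
  by move: xU; apply: filterS => y; exact.
have [n nr] : exists n : nat, n.+1%:R^-1 < r / 2.
  exists (Num.truncn (r / 2)^-1).
  by rewrite invf_plt ?posrE ?divr_gt0//; exact: Num.Theory.truncnS_gt.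
have n0 : (0 : R) < n.+1%:R^-1 by rewrite invr_gt0.
have [d [/= xd Dd]] : B x n.+1%:R^-1 `&` D !=set0.
  by apply: dD => //; exists x; rewrite /B/= distxx.
have [i _ id] := eD d Dd.
exists (pickle (i, n)) => //; rewrite /F pickleK.
have bU : b (i, n) `<=` U.
  move=> y; rewrite /b/B/= id => dy; apply: xrU => /=.
  rewrite (le_lt_trans (distD x d y))// (splitr r) ltrD//.
  - exact: lt_trans nr.
  - exact: lt_trans nr.
rewrite ifT; first by rewrite /b/B/= id distC.
rewrite (le_lt_trans _ (rK _ Uc))// le_measure ?inE//; [exact: mB|].
rewrite -[U]setCK; apply: measurableC; apply: sub_sigma_algebra.
exact: closed_openC.
Qed.
End topology.

Section radon_measure.
Context (R : realType) (T : ptopologicalType).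
Variables (s : {measure set (borel T) -> \bar R}).
Variables (hT : polish R T) (hlc : locally_compact [set: T]) (hs : radon s).

Definition radon_measure of polish R T & locally_compact [set: T] & radon s
  : set (borel T) -> \bar R := s.

Let mu := radon_measure hT hlc hs.
HB.instance Definition _ := Measure.on mu.
HB.instance Definition _ := Measure_isSigmaFinite.Build _ _ _ mu
  (radon_sigma_finite hT hlc hs).

End radon_measure.

(* The canonical sigma-finite structure that the library puts on [m1 \x m2] only
   unifies when both factors are subprobabilities, hence this copy. *)
Section prod_measure.
Context d1 d2 (T1 : measurableType d1) (T2 : measurableType d2) (R : realType).
Variables (m1 : {sigma_finite_measure set T1 -> \bar R})
          (m2 : {sigma_finite_measure set T2 -> \bar R}).

Definition prod_measure : set (T1 * T2) -> \bar R := (m1 \x m2)%E.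

HB.instance Definition _ := Measure.on prod_measure.

Let prod_measure_sigma_finite : sigma_finite setT prod_measure.
Proof.
have /sigma_finiteP[F [TF ndF Foo]] := sigma_finiteT m1.
have /sigma_finiteP[G [TG ndG Goo]] := sigma_finiteT m2.
exists (fun n => F n `*` G n).
  rewrite -setXTT TF TG predeqE => -[x y]; split.
    move=> [/= [n _ Fnx] [k _ Gky]]; exists (maxn n k) => //; split.
    - by move: x Fnx; exact/subsetPset/ndF/leq_maxl.
    - by move: y Gky; exact/subsetPset/ndG/leq_maxr.
  by move=> [n _ []/= ? ?]; split; exists n.
move=> k; have [? ?] := Foo k; have [? ?] := Goo k.
split; first exact: measurableX.
by rewrite [ltLHS]product_measure1E// lte_mul_pinfty// ge0_fin_numE.
Qed.

HB.instance Definition _ := Measure_isSigmaFinite.Build _ _ _ prod_measure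
  prod_measure_sigma_finite.

End prod_measure.

Section power_measure.
Context (R : realType) d (X : measurableType d).

Definition consp n (p : X * n.-tuple X) : n.+1.-tuple X :=
  [tuple of p.1 :: p.2].

Lemma measurable_consp n : measurable_fun setT (@consp n).
Proof. by apply: measurable_cons. Qed.

Section cons_measure.
Variables (n : nat) (mu : {sigma_finite_measure set X -> \bar R}).
Variable (nu : {sigma_finite_measure set (n.-tuple X) -> \bar R}).

Definition cons_measure : set (n.+1.-tuple X) -> \bar R :=
  pushforward (prod_measure mu nu) (@consp n).

Let cons_measure0 : cons_measure set0 = 0%E.
Proof. by rewrite /cons_measure/pushforward preimage_set0 measure0. Qed.

Let cons_measure_ge0 A : (0 <= cons_measure A)%E.
Proof. by rewrite /cons_measure/pushforward; exact: measure_ge0. Qed.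

Let cons_measure_sigma_additive : semi_sigma_additive cons_measure.
Proof.
have m F : measurable F -> measurable (@consp n @^-1` F).
  by move=> mF; rewrite -[X in measurable X]setTI; exact: measurable_consp.
move=> F mF tF mUF; rewrite /cons_measure/pushforward preimage_bigcup.
apply: measure_semi_sigma_additive => [i||]; first exact: m.
- apply/trivIsetP => /= i j _ _ ij; rewrite -preimage_setI.
  by move/trivIsetP : tF => /(_ _ _ _ _ ij) ->//; rewrite preimage_set0.
- by rewrite -preimage_bigcup; exact: m.
Qed.

HB.instance Definition _ := isMeasure.Build _ _ _ cons_measure
  cons_measure0 cons_measure_ge0 cons_measure_sigma_additive.

Let cons_measure_sigma_finite : sigma_finite setT cons_measure.
Proof.
have [F TF Foo] : sigma_finite setT (prod_measure mu nu)
  by exact: sigma_finiteT.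
pose u (t : n.+1.-tuple X) := (thead t, [tuple of behead t] : n.-tuple X).
have mu_ : measurable_fun setT u.
  apply: measurable_fun_pair; last exact: measurable_behead.
  exact: measurable_tnth.
have uK : cancel (@consp n) u.
  by case=> x t; congr (_, _); apply/val_inj.
exists (fun i => u @^-1` (F i)).
  by rewrite -preimage_bigcup -TF preimage_setT.
move=> i; have [mF Fi] := Foo i; split.
  by rewrite -[X in measurable X]setTI; exact: mu_.
rewrite /cons_measure/pushforward -comp_preimage.
by rewrite (_ : u \o _ = id) ?preimage_id//; apply/funext => p; exact: uK.
Qed.

HB.instance Definition _ := Measure_isSigmaFinite.Build _ _ _ cons_measure
  cons_measure_sigma_finite.

End cons_measure.

Fixpoint mpow (mu : {sigma_finite_measure set X -> \bar R}) n
    : {sigma_finite_measure set (n.-tuple X) -> \bar R} :=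
  if n is m.+1 then cons_measure mu (mpow mu m) else \d_([tuple] : 0.-tuple X).

End power_measure.

Section complex_L2.
Context (R : realType) d (X : measurableType d).
Local Open Scope complex_scope.

Definition measurable_cfun (D : set X) (F : X -> R[i]) :=
  measurable_fun D (fun x => complex.Re (F x)) /\
  measurable_fun D (fun x => complex.Im (F x)).

Variable mu : {measure set X -> \bar R}.

Definition sqnorm (F : X -> R[i]) : \bar R :=
  (\int[mu]_x (complex.Re (F x) ^+ 2 + complex.Im (F x) ^+ 2)%:E)%E.

Definition L2 (F : X -> R[i]) := measurable_cfun setT F /\ (sqnorm F < +oo)%E.

Definition cinner (F G : X -> R[i]) : R[i] :=
  (\int[mu]_x complex.Re (F x * (G x)^*))%R +i*
  (\int[mu]_x complex.Im (F x * (G x)^*))%R.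

End complex_L2.

(* [R[i]]-valued functions stand for their classes modulo almost everywhere
   equality; [q] is the kernel Q extended to X = T * R. *)
Section QFock.
Context (R : realType) d (X : measurableType d).
Variables (mu : {sigma_finite_measure set X -> \bar R}) (q : X -> X -> R[i]).
Local Open Scope complex_scope.

Section particles.
Variable n : nat.
Implicit Types (s t : 'S_n) (F : n.-tuple X -> R[i]).

(* The permuted point (z_{s 1}, ..., z_{s n}). *)
Definition permt s (z : n.-tuple X) : n.-tuple X := [tuple tnth z (s i) | i < n].

(* One factor Q(z_i, z_j) for each pair i < j that [s^-1] puts in reverse order.
   [Psi_tperm] and [PsiM] below characterise [Psi]. *)
Definition Qperm s (z : n.-tuple X) : R[i] :=
  \prod_(i < n) \prod_(j < n | (i < j)%N && (s^-1%g j < s^-1%g i)%N)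
    q (tnth z i) (tnth z j).

Definition Psi s F : n.-tuple X -> R[i] := fun z => Qperm s z * F (permt s z).

Definition symP F : n.-tuple X -> R[i] :=
  fun z => (n`!%:R)^-1 * \sum_(s : 'S_n) Psi s F z.

Definition sym_space F :=
  L2 (mpow mu n) F /\
  exists2 G, L2 (mpow mu n) G & \forall z \ae mpow mu n, F z = symP G z.

Lemma Psi_tperm (j k : 'I_n) F z : k = j.+1 :> nat ->
  Psi (tperm j k) F z = q (tnth z j) (tnth z k) * F (permt (tperm j k) z).
Proof.
move=> kj; congr (_ * _); rewrite /Qperm tpermV.
have jk : (j < k)%N by rewrite kj.
rewrite (bigD1 j)//= (bigD1 k)/=; last by rewrite jk tpermL tpermR.
rewrite !big1 ?mulr1// => [i ij|i /andP[/andP[ji +] /eqP ik]].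
- have {}ij : i != j :> nat by [].
  rewrite big1// => l /andP[il].
  by case: (tpermP j k i) => [e|e|_ _]; case: (tpermP j k l) => [e'|e'|_ _] h;
    exfalso; subst; lia.
- have {}ik : i != k :> nat by apply/eqP => /val_inj.
  rewrite tpermL; case: (tpermP j k i) => [e|e|_ _] h; exfalso; subst; lia.
Qed.

Lemma PsiM s t F : (forall x y, q x y * q y x = 1) ->
  Psi s (Psi t F) = Psi (t * s)%g F.
Proof.
move=> qN; apply/funext => z; rewrite /Psi.
have -> : permt t (permt s z) = permt (t * s)%g z.
  by apply: eq_from_tnth => i; rewrite !tnth_mktuple permM.
rewrite mulrA; congr (_ * _).
have pairE (h : 'I_n -> 'I_n -> R[i]) : (forall i, h i i = 1) ->
    \prod_(i < n) \prod_(j < n) h i j =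
    \prod_(i < n) \prod_(j < n | (i < j)%N) (h i j * h j i).
  move=> h1; under [RHS]eq_bigr do rewrite big_split.
  rewrite big_split/= [X in _ * X](exchange_big_dep xpredT)//= -big_split/=.
  apply: eq_bigr => i _; rewrite (bigID (fun j : 'I_n => (i < j)%N))/=.
  congr (_ * _); rewrite (bigID (fun j : 'I_n => (j < i)%N))/=.
  rewrite [X in _ * X]big1 ?mulr1; last first.
    move=> j; rewrite -!leqNgt -eqn_leq => /eqP/val_inj ->; exact: h1.
  by apply: eq_bigl => j; rewrite -leqNgt andbC; case: ltngtP.
have -> : Qperm t (permt s z) = \prod_(i < n) \prod_(j < n)
    (if (s^-1%g i < s^-1%g j)%N && ((t * s)^-1%g j < (t * s)^-1%g i)%N
     then q (tnth z i) (tnth z j) else 1).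
  rewrite /Qperm (reindex_inj (@perm_inj _ s^-1%g))/=.
  apply: eq_bigr => i _; rewrite (reindex_inj (@perm_inj _ s^-1%g))/=.
  rewrite big_mkcond; apply: eq_bigr => j _.
  by rewrite !tnth_mktuple !permKV invMg !permM.
rewrite pairE => [|i]; last by rewrite ltnn.
rewrite /Qperm -big_split/=; apply: eq_bigr => i _.
rewrite big_mkcondr [in RHS]big_mkcondr -big_split/=.
apply: eq_bigr => j ij.
have uij : s^-1%g i != s^-1%g j by rewrite (inj_eq perm_inj) -val_eqE ltn_eqF.
have wij : (t * s)^-1%g i != (t * s)^-1%g j.
  by rewrite (inj_eq perm_inj) -val_eqE ltn_eqF.
move: uij wij; rewrite -!val_eqE/=.
by case: ltngtP => // _ _; case: ltngtP => //= _ _; rewrite ?mulr1 ?mul1r ?qN.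
Qed.

End particles.

Definition fockseq := forall n, n.-tuple X -> R[i].
HB.instance Definition _ := gen_eqMixin fockseq.
HB.instance Definition _ := gen_choiceMixin fockseq.

Implicit Types (F G H : fockseq) (h : X -> R).

Definition fock F := (forall n, sym_space (F n)) /\
  (\sum_(0 <= n <oo) n`!%:R%:E * sqnorm (mpow mu n) (F n) < +oo)%E.

Definition finite_fock F := (forall n, sym_space (F n)) /\
  exists N, forall n, (N < n)%N -> \forall z \ae mpow mu n, F n z = 0.

Definition fock_inner F G : R[i] :=
  let u n := n`!%:R * cinner (mpow mu n) (F n) (G n) in
  limn (series (fun n => complex.Re (u n))) +i*
  limn (series (fun n => complex.Im (u n))).

Definition vacuum : fockseq := fun n _ => (n == 0%N)%:R.

Definition tensor h n (F : n.-tuple X -> R[i]) : n.+1.-tuple X -> R[i] :=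
  fun z => (h (thead z))%:C * F [tuple of behead z].

Definition creation h F : fockseq := fun n =>
  if n is k.+1 then symP (tensor h (F k)) else fun=> 0.

Definition neutral h F : fockseq := fun n z =>
  (\sum_(i < n) h (tnth z i))%:C * F n z.

(* Any two adjoint vectors agree almost everywhere in each degree, so the choice
   made by [xget] is immaterial. *)
Definition annihilation h F : fockseq :=
  xget (fun _ _ => 0) [set G : fockseq | fock G /\
    forall H, finite_fock H -> fock_inner (creation h H) F = fock_inner H G].

Definition fock_add F G : fockseq := fun n z => F n z + G n z.

Definition vacuum_state (p : fockseq -> fockseq) : R[i] :=
  fock_inner (p vacuum) vacuum.

Definition op_prod n (p : 'I_n -> fockseq -> fockseq) : fockseq -> fockseq :=
  \big[comp/id]_(i < n) p i.

End QFock.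

Section field.
Context (R : realType) (T : ptopologicalType).

(* The extension of Q to [phase T R]. Q is only given off the null set A; the value
   1 on A keeps the kernel measurable, unimodular and hermitian everywhere, and does
   not affect any class modulo almost everywhere equality. *)
Definition Qext (A : set (borel T * borel T)%type) (Q : T -> T -> R[i])
    (z w : phase T R) : R[i] :=
  if (z.1, w.1) \in A then 1 else Q z.1 w.1.

Variables (mu : {sigma_finite_measure set (phase T R) -> \bar R}).
Variable q : phase T R -> phase T R -> R[i].

(* f (x) mu_k, where mu_k(x) = x^k. *)
Definition xpow (f : T -> R) k (z : phase T R) : R := f z.1 * z.2 ^+ k.

(* All three summands make sense on arbitrary sequences; the operator of interest is
   the restriction to the invariant domain of finite sequences of symmetrised
   polynomials in the x_i, which contains the vacuum, so that domain contains every
   vector to which [xi] is applied in a [vacuum_state] of a product of [xi]s. *)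
Definition xi (f : T -> R) (F : fockseq R (phase T R)) : fockseq R (phase T R) :=
  fock_add (fock_add (creation q (xpow f 0) F) (neutral (xpow f 1) F))
    (annihilation mu q (xpow f 0) F).

End field.

(* Main.v *)
(** Up to the weight [n!], the state built by the [g]-fields on top of a vector [v]
    whose particles all lie in A' is the symmetrised tensor product of [gs Omega]
    and [v]: on a configuration listing first j particles [z] of B' and then l
    particles [y] of A', one has [(j+l)! G(z,y) = j! l! u(z) v(y)]. Each of creation,
    neutral and annihilation parts of a field localised in B' preserves this
    relation, acting on [u] only. Restricting to configurations without B'
    particles gives [G = tau(gs) v] there, and fields localised in A' only see such
    configurations, so they preserve this proportionality down to degree 0.

    The annihilation operator is an arbitrary adjoint, hence is only known almost
    everywhere. On functions bounded by [C prod_i w(z_i)^N], with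
    [w(t,x) = 1_K(t) (1 + |x|)], it agrees with an explicit integral; existence
    is Fubini and the invariance of product measures under permutations, and
    uniqueness is tested against vectors of a single degree. *)

Require Import Defs.
From HB Require Import structures.
From mathcomp Require Import all_boot all_order all_algebra all_fingroup.
From mathcomp Require Import all_classical all_reals all_analysis.
From mathcomp Require Import measurable_realfun complex ring lra zify.

Set Implicit Arguments.
Unset Strict Implicit.
Unset Printing Implicit Defensive.

Import Order.TTheory GRing.Theory Num.Theory.
Import numFieldNormedType.Exports.
Import ComplexField.Normc.

Local Open Scope classical_set_scope.
Local Open Scope ring_scope.
Local Open Scope complex_scope.
(* Opened again so that [x^*] parses as [Num.conj x], not [conjc x]. *)
Local Open Scope ring_scope.

(** * Complex-valued functions *)

(** The order of listing carries the argument. A particle created in B' at a position among the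
    leading B' particles is brought to the front across B' particles only, so its phase is the one
    it would acquire without the A' particles, and no value of Q between A' and B' enters these
    identities. Q-symmetry determines the values on all other orderings.

    Since [Qext] is unimodular and hermitian at every point, vectors can be represented by functions
    that are Q-symmetric everywhere. The identities then hold on each single configuration, and null
    sets intervene only through the chosen adjoint.

    The outer f-fields act on a vector that is not globally a multiple of v. Its components with B'
    particles are never read: creating or annihilating in A' leads from configurations inside A' to
    configurations inside A'.

    The weight takes no value strictly between 0 and 1, so its powers increase with the exponent. A
    field then only changes C and raises N, and the exponential moment of nu makes every power
    integrable. *)

Section complex_numbers.
Context (R : rcfType).
Implicit Types x y : R[i].

Lemma ReM x y : complex.Re (x * y) =
  complex.Re x * complex.Re y - complex.Im x * complex.Im y.
Proof. by case: x y => [a b] [c e]. Qed.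

Lemma ImM x y : complex.Im (x * y) =
  complex.Re x * complex.Im y + complex.Im x * complex.Re y.
Proof. by case: x y => [a b] [c e]. Qed.

Lemma ReD x y : complex.Re (x + y) = complex.Re x + complex.Re y.
Proof. by case: x y => [a b] [c e]. Qed.

Lemma ImD x y : complex.Im (x + y) = complex.Im x + complex.Im y.
Proof. by case: x y => [a b] [c e]. Qed.

Lemma ReN x : complex.Re (- x) = - complex.Re x.
Proof. by case: x. Qed.

Lemma ImN x : complex.Im (- x) = - complex.Im x.
Proof. by case: x. Qed.

Lemma ReJ x : complex.Re x^* = complex.Re x.
Proof. by case: x. Qed.

Lemma ImJ x : complex.Im x^* = - complex.Im x.
Proof. by case: x. Qed.

Lemma conjcM x y : (x * y)^* = x^* * y^*.
Proof. exact: rmorphM. Qed.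

Lemma conjc_natC n : (n%:R : R[i])^* = n%:R.
Proof. exact: rmorph_nat. Qed.

Lemma conjc_realC (a : R) : (a%:C)^* = a%:C.
Proof. by apply/eqP; rewrite eq_complex/= oppr0 !eqxx. Qed.

Lemma sqr_normc x :
  normc x ^+ 2 = complex.Re x ^+ 2 + complex.Im x ^+ 2.
Proof.
by case: x => a b; rewrite /normc sqr_sqrtr// addr_ge0 ?sqr_ge0.
Qed.

Lemma normc_ge0 x : 0 <= normc x.
Proof. by case: x => a b; exact: sqrtr_ge0. Qed.

Lemma normcD_le x y : normc (x + y) <= normc x + normc y.
Proof. exact: le_normcD. Qed.

Lemma Re_le_normc x : `|complex.Re x| <= normc x.
Proof.
rewrite -ler_sqr ?nnegrE ?normc_ge0// sqr_normc real_normK ?num_real//.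
by rewrite lerDl sqr_ge0.
Qed.

Lemma Im_le_normc x : `|complex.Im x| <= normc x.
Proof.
rewrite -ler_sqr ?nnegrE ?normc_ge0// sqr_normc real_normK ?num_real//.
by rewrite lerDr sqr_ge0.
Qed.

Lemma normc_le_ReIm x : normc x <= `|complex.Re x| + `|complex.Im x|.
Proof.
rewrite -ler_sqr ?nnegrE ?normc_ge0 ?addr_ge0// sqr_normc.
rewrite sqrrD !real_normK ?num_real// -addrA lerD2l lerDr.
by rewrite mulrn_wge0// mulr_ge0.
Qed.

Lemma normcJ x : normc x^* = normc x.
Proof. by case: x => a b /=; rewrite sqrrN. Qed.

Lemma normcR (a : R) : normc a%:C = `|a|.
Proof. by rewrite /= expr0n/= addr0 sqrtr_sqr. Qed.

Lemma normc_nat n : normc (n%:R : R[i]) = n%:R.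
Proof. by rewrite -(rmorph_nat (real_complex R)) normcR normr_nat. Qed.

Lemma normc_prod (I : Type) (r : seq I) (P : pred I) (F : I -> R[i]) :
  normc (\prod_(i <- r | P i) F i) = \prod_(i <- r | P i) normc (F i).
Proof. by apply: (big_morph (@normc R)); [exact: normcM|exact: normc1]. Qed.

Lemma normc_sum_le (I : Type) (r : seq I) (P : pred I) (F : I -> R[i]) :
  normc (\sum_(i <- r | P i) F i) <= \sum_(i <- r | P i) normc (F i).
Proof.
elim/big_ind2 : _ => //; first by rewrite normc0.
by move=> x1 a x2 b ax bx; rewrite (le_trans (normcD_le _ _))// lerD.
Qed.

Lemma mulcJ_normc1 x : normc x = 1 -> x * x^* = 1.
Proof.
move=> x1; have := sqr_normc x; rewrite x1; case: x {x1} => a b /= h.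
apply/eqP; rewrite eq_complex/=; apply/andP; split; apply/eqP; lra.
Qed.

End complex_numbers.

Section measurable_complex.
Context (R : realType) d (X : measurableType d).
Implicit Types F G : X -> R[i].
Local Notation mfun := (@measurable_cfun R d X setT).

Lemma measurable_cfunM F G : mfun F -> mfun G -> mfun (fun x => F x * G x).
Proof.
move=> [F1 F2] [G1 G2]; split.
- under eq_fun do rewrite ReM.
  by apply: measurable_funB; exact: measurable_funM.
- under eq_fun do rewrite ImM.
  by apply: measurable_funD; exact: measurable_funM.
Qed.

Lemma measurable_cfunD F G : mfun F -> mfun G -> mfun (fun x => F x + G x).
Proof.
move=> [F1 F2] [G1 G2]; split.
- by under eq_fun do rewrite ReD; exact: measurable_funD.
- by under eq_fun do rewrite ImD; exact: measurable_funD.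
Qed.

Lemma measurable_cfunN F : mfun F -> mfun (fun x => - F x).
Proof.
move=> [F1 F2]; split.
- by under eq_fun do rewrite ReN; exact: measurable_funN.
- by under eq_fun do rewrite ImN; exact: measurable_funN.
Qed.

Lemma measurable_cfunJ F : mfun F -> mfun (fun x => (F x)^*).
Proof.
move=> [F1 F2]; split.
- by under eq_fun do rewrite ReJ.
- by under eq_fun do rewrite ImJ; exact: measurable_funN.
Qed.

Lemma measurable_cfun_cst (c : R[i]) : mfun (fun=> c).
Proof. by split; exact: measurable_cst. Qed.

Lemma measurable_cfun_real (h : X -> R) :
  measurable_fun setT h -> mfun (fun x => (h x)%:C).
Proof. by move=> mh; split => //=; exact: measurable_cst. Qed.

Lemma measurable_cfun_comp d' (Y : measurableType d') (phi : Y -> X) F :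
  measurable_fun setT phi -> mfun F -> measurable_cfun setT (F \o phi).
Proof.
move=> mphi [F1 F2]; split.
- exact: (measurableT_comp F1 mphi).
- exact: (measurableT_comp F2 mphi).
Qed.

Lemma measurable_cfun_sum (I : Type) (r : seq I) (P : pred I) (F : I -> X -> R[i]) :
  (forall i, mfun (F i)) -> mfun (fun x => \sum_(i <- r | P i) F i x).
Proof.
move=> mF; elim: r => [|i r ih].
  rewrite (_ : (fun x => _) = fun=> 0); first exact: measurable_cfun_cst.
  by apply/funext => x; rewrite big_nil.
rewrite (_ : (fun x => _) = fun x => if P i then F i x + \sum_(j <- r | P j) F j x
  else \sum_(j <- r | P j) F j x); last by apply/funext => x; rewrite big_cons.
by case: (P i) => //; exact: measurable_cfunD.
Qed.

Lemma measurable_cfun_prod (I : Type) (r : seq I) (P : pred I) (F : I -> X -> R[i]) :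
  (forall i, mfun (F i)) -> mfun (fun x => \prod_(i <- r | P i) F i x).
Proof.
move=> mF; elim: r => [|i r ih].
  rewrite (_ : (fun x => _) = fun=> 1); first exact: measurable_cfun_cst.
  by apply/funext => x; rewrite big_nil.
rewrite (_ : (fun x => _) = fun x => if P i then F i x * \prod_(j <- r | P j) F j x
  else \prod_(j <- r | P j) F j x); last by apply/funext => x; rewrite big_cons.
by case: (P i) => //; exact: measurable_cfunM.
Qed.

End measurable_complex.

(** * Integrals of complex-valued functions *)

Section complex_integral.
Context (R : realType) d (X : measurableType d).
Variable mu : {measure set X -> \bar R}.
Implicit Types F G : X -> R[i].

Definition cintegrable F :=
  mu.-integrable setT (EFin \o (fun x => complex.Re (F x))) /\
  mu.-integrable setT (EFin \o (fun x => complex.Im (F x))).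

Definition cintegral F : R[i] :=
  (\int[mu]_x complex.Re (F x))%R +i* (\int[mu]_x complex.Im (F x))%R.

Lemma cinnerE F G : cinner mu F G = cintegral (fun x => F x * (G x)^*).
Proof. by []. Qed.

Lemma cintegrable_le F (g : X -> R) : measurable_cfun setT F ->
  mu.-integrable setT (EFin \o g) -> (forall x, normc (F x) <= g x) ->
  cintegrable F.
Proof.
move=> [F1 F2] ig Fg; split; apply: (le_integrable _ _ _ ig) => //.
- exact/measurable_EFinP.
- move=> x _; rewrite /= lee_fin (le_trans (Re_le_normc _))//.
  by rewrite (le_trans (Fg x))// ler_norm.
- exact/measurable_EFinP.
- move=> x _; rewrite /= lee_fin (le_trans (Im_le_normc _))//.
  by rewrite (le_trans (Fg x))// ler_norm.
Qed.

(** The factor 2 comes from bounding real and imaginary parts separately; it is harmless, since only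
    the finiteness of the constant matters later. *)
Lemma normc_cintegral_le F (g : X -> R) : cintegrable F ->
  mu.-integrable setT (EFin \o g) -> (forall x, normc (F x) <= g x) ->
  normc (cintegral F) <= 2 * (\int[mu]_x g x)%R.
Proof.
move=> [F1 F2] ig Fg; rewrite (le_trans (normc_le_ReIm _))// mulr_natl mulr2n.
have aux (u : X -> R) : mu.-integrable setT (EFin \o u) ->
    (forall x, `|u x| <= normc (F x)) ->
    `|(\int[mu]_x u x)%R| <= (\int[mu]_x g x)%R.
  move=> iu ub; rewrite (le_trans (le_normr_Rintegral _ _))//.
  apply: le_Rintegral => //; first exact: integrable_norm.
  by move=> x _; rewrite (le_trans (ub x)).
by apply: lerD; apply: aux => // x; [exact: Re_le_normc|exact: Im_le_normc].
Qed.

Lemma cintegrableD F G : cintegrable F -> cintegrable G ->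
  cintegrable (fun x => F x + G x).
Proof.
move=> [F1 F2] [G1 G2]; split.
- rewrite (_ : _ \o _ = (EFin \o (fun x => complex.Re (F x))) \+
    (EFin \o (fun x => complex.Re (G x)))).
    exact: integrableD.
  by apply/funext => x/=; rewrite ReD.
- rewrite (_ : _ \o _ = (EFin \o (fun x => complex.Im (F x))) \+
    (EFin \o (fun x => complex.Im (G x)))).
    exact: integrableD.
  by apply/funext => x/=; rewrite ImD.
Qed.

Lemma cintegralD F G : cintegrable F -> cintegrable G ->
  cintegral (fun x => F x + G x) = cintegral F + cintegral G.
Proof.
move=> [F1 F2] [G1 G2]; rewrite /cintegral; apply/eqP; rewrite eq_complex/=.
apply/andP; split; apply/eqP; rewrite -RintegralD//; apply: eq_Rintegral => x _.
- by rewrite ReD.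
- by rewrite ImD.
Qed.

Lemma cintegrableZ F c : cintegrable F -> cintegrable (fun x => c * F x).
Proof.
move=> [F1 F2]; split.
- rewrite (_ : _ \o _ = (fun x => (complex.Re c)%:E * (EFin \o (fun x => complex.Re (F x))) x
    - (complex.Im c)%:E * (EFin \o (fun x => complex.Im (F x))) x)%E).
    by apply: integrableB => //; exact: integrableZl.
  by apply/funext => x/=; rewrite ReM.
- rewrite (_ : _ \o _ = (fun x => (complex.Re c)%:E * (EFin \o (fun x => complex.Im (F x))) x
    + (complex.Im c)%:E * (EFin \o (fun x => complex.Re (F x))) x)%E).
    by apply: integrableD => //; exact: integrableZl.
  by apply/funext => x/=; rewrite ImM.
Qed.

Lemma cintegralZ F c : cintegrable F ->
  cintegral (fun x => c * F x) = c * cintegral F.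
Proof.
move=> [F1 F2]; rewrite /cintegral; apply/eqP; rewrite eq_complex; apply/andP; split; apply/eqP.
- rewrite ReM/= -!RintegralZl// -RintegralB//.
  + by apply: eq_Rintegral => x _; rewrite ReM.
  + exact: integrableZl F1.
  + exact: integrableZl F2.
- rewrite ImM/= -!RintegralZl// -RintegralD//.
  + by apply: eq_Rintegral => x _; rewrite ImM.
  + exact: integrableZl F2.
  + exact: integrableZl F1.
Qed.

Lemma cintegrable0 : cintegrable (fun=> 0).
Proof. by split; exact: integrable0. Qed.

Lemma cintegral0 : cintegral (fun=> 0) = 0.
Proof. by rewrite /cintegral !Rintegral_cst// !mul0r. Qed.

Lemma cintegralJ F : cintegrable F ->
  cintegral (fun x => (F x)^*) = (cintegral F)^*.
Proof.
move=> [F1 F2]; rewrite /cintegral; apply/eqP; rewrite eq_complex/=; apply/andP; split; apply/eqP.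
  by apply: eq_Rintegral => x _; rewrite ReJ.
rewrite -mulN1r -RintegralZl//; apply: eq_Rintegral => x _.
by rewrite ImJ mulN1r.
Qed.

Lemma cintegral_ae F G : measurable_cfun setT F -> measurable_cfun setT G ->
  (\forall x \ae mu, F x = G x) -> cintegral F = cintegral G.
Proof.
move=> [F1 F2] [G1 G2] FG; rewrite /cintegral /Rintegral.
congr (fine _ +i* fine _); apply: ae_eq_integral => //; try exact/measurable_EFinP.
- by apply: filterS FG => x /= ->.
- by apply: filterS FG => x /= ->.
Qed.

Lemma cintegrable_sum (I : Type) (r : seq I) (F : I -> X -> R[i]) :
  (forall i, cintegrable (F i)) -> cintegrable (fun x => \sum_(i <- r) F i x).
Proof.
move=> iF; elim: r => [|i r ih].
  rewrite (_ : (fun x => _) = fun=> 0); first exact: cintegrable0.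
  by apply/funext => x; rewrite big_nil.
rewrite (_ : (fun x => _) = fun x => F i x + \sum_(j <- r) F j x).
  exact: cintegrableD.
by apply/funext => x; rewrite big_cons.
Qed.

Lemma cintegral_sum (I : Type) (r : seq I) (F : I -> X -> R[i]) :
  (forall i, cintegrable (F i)) ->
  cintegral (fun x => \sum_(i <- r) F i x) = \sum_(i <- r) cintegral (F i).
Proof.
move=> iF; elim: r => [|i r ih].
  rewrite (_ : (fun x => _) = fun=> 0) ?cintegral0 ?big_nil//.
  by apply/funext => x; rewrite big_nil.
rewrite (_ : (fun x => _) = fun x => F i x + \sum_(j <- r) F j x); last first.
  by apply/funext => x; rewrite big_cons.
by rewrite cintegralD ?ih ?big_cons//; exact: cintegrable_sum.
Qed.

End complex_integral.

(** * Power measures *)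

Section power_measure_permutation.
Context (R : realType) d (X : measurableType d).
Variable mu : {sigma_finite_measure set X -> \bar R}.

Definition box n (A : 'I_n -> set X) : set (n.-tuple X) :=
  [set z | forall i, A i (tnth z i)].

Lemma measurable_box n (A : 'I_n -> set X) : (forall i, measurable (A i)) ->
  measurable (box A).
Proof.
move=> mA; rewrite (_ : box A = \big[setI/setT]_(i < n) (@tnth n X ^~ i @^-1` A i)).
  apply: bigsetI_measurable => i _.
  by rewrite -[X in measurable X]setTI; exact: measurable_tnth.
apply/seteqP; split => z; rewrite -bigcap_seq/= => zA i.
  by move=> _; exact: zA.
by apply: zA; rewrite /= mem_index_enum.
Qed.

Lemma mpow_box n (A : 'I_n -> set X) : (forall i, measurable (A i)) ->
  (mpow mu n (box A) = \prod_(i < n) mu (A i))%E.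
Proof.
elim: n A => [|n ih] A mA /=.
  rewrite big_ord0 diracE (_ : _ \in _ = true)//.
  by apply/mem_set => -[].
rewrite /cons_measure/pushforward/prod_measure.
have -> : @consp _ _ n @^-1` box A =
    A ord0 `*` box (fun i => A (lift ord0 i)).
  apply/seteqP; split => [[x t] /= h|[x t] [/= h1 h2] i].
    split; first by have := h ord0; rewrite /consp/= (tnth_nth x).
    by move=> i; have := h (lift ord0 i); rewrite tnthS.
  have [j ->|->] := unliftP ord0 i; last by rewrite /consp (tnth_nth x).
  by rewrite tnthS.
rewrite product_measure1E//; last exact: measurable_box.
by rewrite ih// big_ord_recl.
Qed.

Lemma measurable_permt n (s : 'S_n) :
  measurable_fun setT (@permt _ X n s).
Proof.
apply/measurable_fun_tnthP => i.
rewrite (_ : _ \o _ = fun z => tnth z (s i)); first exact: measurable_tnth.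
by apply/funext => z /=; rewrite tnth_mktuple.
Qed.

(** Boxes are stable under intersection, so once they generate the sigma-algebra a sigma-finite
    measure on tuples can be identified by its values on them. *)
Lemma box_measurableE n :
  measurable = <<s [set box A | A in [set A : 'I_n -> set X | forall i, measurable (A i)]] >>.
Proof.
apply/seteqP; split.
  apply: smallest_sub; first exact: smallest_sigma_algebra.
  rewrite -bigcup_seq => _ [i _ [A mA <-]]; rewrite setTI.
  apply: sub_sigma_algebra.
  exists (fun j => if j == i then A else setT).
    by move=> j; case: ifPn.
  apply/seteqP; split => z /=.
    by move=> /(_ i); rewrite eqxx.
  by move=> Az j; case: ifPn => // /eqP ->.
apply: smallest_sub; first exact: sigma_algebra_measurable.
by move=> _ [A mA <-]; exact: measurable_box.
Qed.

(** On boxes the invariance is commutativity of the product of the side measures; uniqueness of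
    measures on a generating pi-system extends it to all measurable sets. *)
Lemma mpow_permt n (s : 'S_n) (Y : set (n.-tuple X)) : measurable Y ->
  mpow mu n (@permt _ X n s @^-1` Y) = mpow mu n Y.
Proof.
have mp := measurable_permt s.
have /sigma_finiteP[F [TF ndF Foo]] := sigma_finiteT mu.
pose p : {measure set (n.-tuple X) -> \bar R} :=
  [the measure _ _ of pushforward (mpow mu n) (@permt _ X n s)].
pose g k : set (n.-tuple X) := box (fun=> F k).
have mF k : measurable (F k) by have [] := Foo k.
move=> mY; suff: p mp Y = mpow mu n Y by [].
apply: (measure_unique _ g (box_measurableE n) _ _ _ (p mp) (mpow mu n)) => //.
- move=> _ _ [A mA <-] [B mB <-]; exists (fun i => A i `&` B i).
    by move=> i; exact: measurableI.
  apply/seteqP; split => z /=.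
    by move=> h; split => i; have [] := h i.
  by move=> [hA hB] i.
- by move=> k; exists (fun=> F k).
- apply/seteqP; split => // z _.
  have /choice[k hk] : forall i, exists k, F k (tnth z i).
    move=> i; have : setT (tnth z i) by [].
    by rewrite TF => -[k _ ?]; exists k.
  (* The sets [F k] increase, so the largest of the n indices serves all coordinates at once. *)
  exists (\max_(i < n) k i)%N => // i.
  have /subsetPset := ndF _ _ (leq_bigmax i : (k i <= \max_(i < n) k i)%N).
  exact.
- move=> _ [A /= mA <-]; rewrite [LHS](_ : _ = mpow mu n (box (fun i => A (s^-1%g i)))).
    rewrite !mpow_box// (reindex_inj (@perm_inj _ s))/=.
    by apply: eq_bigr => i _; rewrite permK.
  rewrite /p/= /pushforward; congr (mpow _ _ _).
  apply/seteqP; split => z /= h i.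
    by have := h (s^-1%g i); rewrite tnth_mktuple permKV.
  by rewrite tnth_mktuple; have := h (s i); rewrite permK.
- move=> k; rewrite /p/= /pushforward.
  rewrite [ltLHS](_ : _ = mpow mu n (g k)).
    rewrite mpow_box//; elim/big_rec : _ => [|i x _ xoo]; first by rewrite ltry.
    rewrite lte_mul_pinfty//.
      by rewrite ge0_fin_numE//; have [] := Foo k.
  congr (mpow _ _ _).
  apply/seteqP; split => z /= h i.
    by have := h (s^-1%g i); rewrite tnth_mktuple permKV.
  by rewrite tnth_mktuple; have := h (s i).
Qed.

End power_measure_permutation.

(** * Integration against power measures *)

Section power_measure_integral.
Context (R : realType) d (X : measurableType d).
Variable mu : {sigma_finite_measure set X -> \bar R}.

Lemma ge0_integral_permt n (s : 'S_n) (f : n.-tuple X -> \bar R) :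
  measurable_fun setT f -> (forall z, 0 <= f z)%E ->
  (\int[mpow mu n]_z f (permt s z) = \int[mpow mu n]_z f z)%E.
Proof.
move=> mf f0; have mp := @measurable_permt _ X n s.
have := ge0_integral_pushforward mp (mpow mu n) (@measurableT _ _) mf.
rewrite preimage_setT => <-//.
by apply: eq_measure_integral => A mA _; exact: mpow_permt.
Qed.

Lemma integrable_permt n (s : 'S_n) (f : n.-tuple X -> \bar R) :
  (mpow mu n).-integrable setT f -> (mpow mu n).-integrable setT (f \o permt s).
Proof.
move=> /integrableP[mf foo]; apply/integrableP; split.
  exact: (measurableT_comp mf (measurable_permt s)).
rewrite (ge0_integral_permt s (f := abse \o f))//=.
by apply: measurableT_comp.
Qed.

Lemma integral_permt n (s : 'S_n) (f : n.-tuple X -> \bar R) :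
  (mpow mu n).-integrable setT f ->
  (\int[mpow mu n]_z f (permt s z) = \int[mpow mu n]_z f z)%E.
Proof.
move=> intf; have mf := measurable_int _ intf.
rewrite integralE [RHS]integralE; congr (_ - _)%E.
  rewrite -[RHS](ge0_integral_permt s (measurable_funepos mf))//.
  by apply: eq_integral => z _; rewrite -[LHS]/((f \o permt s)^\+%E z) funepos_comp.
rewrite -[RHS](ge0_integral_permt s (measurable_funeneg mf))//.
by apply: eq_integral => z _; rewrite -[LHS]/((f \o permt s)^\-%E z) funeneg_comp.
Qed.

Lemma cintegrable_permt n (s : 'S_n) (F : n.-tuple X -> R[i]) :
  cintegrable (mpow mu n) F ->
  cintegrable (mpow mu n) (fun z => F (permt s z)).
Proof.
move=> [F1 F2]; split.
- exact: (integrable_permt s F1).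
- exact: (integrable_permt s F2).
Qed.

Lemma cintegral_permt n (s : 'S_n) (F : n.-tuple X -> R[i]) :
  cintegrable (mpow mu n) F ->
  cintegral (mpow mu n) (fun z => F (permt s z)) = cintegral (mpow mu n) F.
Proof.
move=> [F1 F2]; rewrite /cintegral /Rintegral.
by rewrite (integral_permt s F1) (integral_permt s F2).
Qed.

Lemma ae_permt n (s : 'S_n) (P : n.-tuple X -> Prop) :
  (\forall z \ae mpow mu n, P z) -> \forall z \ae mpow mu n, P (permt s z).
Proof.
move=> [N [mN N0 PN]]; exists (permt s @^-1` N); split.
- by rewrite -[X in measurable X]setTI; exact: measurable_permt.
- by rewrite mpow_permt.
- by move=> z /= h; exact: PN.
Qed.

Definition tbehead n (z : n.+1.-tuple X) : n.-tuple X := [tuple of behead z].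

Lemma tbehead_consp n x (t : n.-tuple X) : tbehead (consp (x, t)) = t.
Proof. exact/val_inj. Qed.

(** The cylinder over a null set is null even when [mu] is infinite, because infinity times 0 is
    0. *)
Lemma ae_behead n (P : n.-tuple X -> Prop) :
  (\forall t \ae mpow mu n, P t) ->
  \forall z \ae mpow mu n.+1, P (tbehead z).
Proof.
move=> [N [mN N0 PN]].
exists (@tbehead n @^-1` N); split.
- by rewrite -[X in measurable X]setTI; exact: measurable_behead.
- rewrite /= /cons_measure/pushforward/prod_measure.
  rewrite [X in product_measure1 _ _ X](_ : _ = setT `*` N).
    by rewrite product_measure1E// N0 mule0.
  by apply/seteqP; split => -[x t] /=; rewrite tbehead_consp => // -[].
- by move=> z /= h; exact: PN.
Qed.

Lemma ge0_integral_mpowS n (f : n.+1.-tuple X -> \bar R) :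
  measurable_fun setT f -> (forall z, 0 <= f z)%E ->
  (\int[mpow mu n.+1]_z f z =
   \int[mpow mu n]_t \int[mu]_x f (consp (x, t)))%E.
Proof.
move=> mf f0; have mc := @measurable_consp _ X n.
have := ge0_integral_pushforward mc (prod_measure mu (mpow mu n)) (@measurableT _ _) mf.
rewrite preimage_setT => /(_ (fun _ _ => f0 _)) ->.
rewrite [LHS](fubini_tonelli2 (m1 := mu) (m2 := mpow mu n) (f \o @consp _ X n))//=.
exact: measurableT_comp.
Qed.

Lemma integrable_mpowS n (f : n.+1.-tuple X -> \bar R) :
  (mpow mu n.+1).-integrable setT f ->
  (mu \x mpow mu n)%E.-integrable setT (f \o @consp _ X n).
Proof.
have mc := @measurable_consp _ X n.
move=> /integrableP[mf foo]; apply/integrableP; split.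
  exact: measurableT_comp.
apply: le_lt_trans foo; rewrite le_eqVlt; apply/orP; left; apply/eqP.
have := ge0_integral_pushforward mc (prod_measure mu (mpow mu n)) (@measurableT _ _)
  (f := abse \o f).
rewrite preimage_setT => ->//=.
exact: measurableT_comp.
Qed.

Lemma integral_mpowS n (f : n.+1.-tuple X -> \bar R) :
  (mpow mu n.+1).-integrable setT f ->
  (\int[mpow mu n.+1]_z f z =
   \int[mpow mu n]_t \int[mu]_x f (consp (x, t)))%E.
Proof.
have mc := @measurable_consp _ X n.
move=> intf; have intfc := integrable_mpowS intf.
have := integral_pushforward mc (mu := prod_measure mu (mpow mu n)) (measurable_int _ intf).
move=> /(_ setT); rewrite preimage_setT => ->//.
by rewrite [RHS](integral21_prod_meas1 intfc).
Qed.

Lemma measurable_cintegral_consp n (F : n.+1.-tuple X -> R[i]) :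
  cintegrable (mpow mu n.+1) F ->
  measurable_cfun setT (fun t : n.-tuple X => cintegral mu (fun x => F (consp (x, t)))).
Proof.
have aux (f : n.+1.-tuple X -> \bar R) : (mpow mu n.+1).-integrable setT f ->
    measurable_fun setT (fun t => fine (\int[mu]_x f (consp (x, t)))%E).
  move=> /integrable_mpowS/measurable_fubini_G mf.
  by apply: measurableT_comp mf; exact: fine_measurable.
by move=> [F1 F2]; split; [exact: aux F1|exact: aux F2].
Qed.

(** Every section, not just almost every one, is assumed integrable, so that the finite parts of the
    inner integrals agree with the extended integrals at each [t]. Bounds by powers of a weight
    provide this. *)
Lemma cintegral_mpowS n (F : n.+1.-tuple X -> R[i]) :
  cintegrable (mpow mu n.+1) F ->
  (forall t, cintegrable mu (fun x => F (consp (x, t)))) ->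
  cintegral (mpow mu n.+1) F =
  cintegral (mpow mu n) (fun t => cintegral mu (fun x => F (consp (x, t)))).
Proof.
have aux (f : n.+1.-tuple X -> R) : (mpow mu n.+1).-integrable setT (EFin \o f) ->
    (forall t, mu.-integrable setT (fun x => (f (consp (x, t)))%:E)) ->
    fine (\int[mpow mu n.+1]_z (f z)%:E)%E =
    fine (\int[mpow mu n]_t (fine (\int[mu]_x (f (consp (x, t)))%:E))%:E)%E.
  move=> intf ift; have := integral_mpowS intf; rewrite /comp => ->.
  congr fine; apply: eq_integral => t _; rewrite fineK//.
  exact: integrable_fin_num.
move=> [F1 F2] iF; congr (_ +i* _); apply: aux => // t.
- by have [] := iF t.
- by have [] := iF t.
Qed.

Lemma integrable_tensor n (a : X -> R) (b : n.-tuple X -> R) :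
  (forall x, 0 <= a x) -> (forall t, 0 <= b t) ->
  mu.-integrable setT (EFin \o a) -> (mpow mu n).-integrable setT (EFin \o b) ->
  (mpow mu n.+1).-integrable setT (fun z => (a (thead z) * b (tbehead z))%:E).
Proof.
move=> a0 b0 ia ib.
have ma : measurable_fun setT a by apply/measurable_EFinP; exact: measurable_int ia.
have mb : measurable_fun setT b by apply/measurable_EFinP; exact: measurable_int ib.
have mab : measurable_fun setT (fun z : n.+1.-tuple X => (a (thead z) * b (tbehead z))%:E).
  apply/measurable_EFinP; apply: measurable_funM.
    by apply: (measurableT_comp ma); exact: measurable_tnth.
  by apply: (measurableT_comp mb); exact: measurable_behead.
apply/integrableP; split => //.
under eq_integral do rewrite gee0_abs ?lee_fin ?mulr_ge0//.
rewrite (ge0_integral_mpowS mab); last by move=> z; rewrite lee_fin mulr_ge0.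
rewrite (_ : integral _ _ _ = \int[mpow mu n]_t ((b t)%:E * \int[mu]_x (a x)%:E))%E; last first.
  apply: eq_integral => t _.
  rewrite -ge0_integralZl//; [|exact/measurable_EFinP
    |by move=> x _; rewrite lee_fin|by rewrite lee_fin].
  by apply: eq_integral => x _; rewrite theadE tbehead_consp mulrC EFinM.
rewrite ge0_integralZr//; last first.
- by apply: integral_ge0 => x _; rewrite lee_fin.
- by move=> x _; rewrite lee_fin.
- exact/measurable_EFinP.
rewrite lte_mul_pinfty//.
- by apply: integral_ge0 => x _; rewrite lee_fin.
- exact: integrable_fin_num.
- exact: integrable_lty ia.
Qed.

End power_measure_integral.

(** * Product weights *)

Section weight.
Context (R : realType) d (X : measurableType d).
Variable mu : {sigma_finite_measure set X -> \bar R}.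
Variable w : X -> R.
Hypothesis mw : measurable_fun setT w.
Hypothesis w0 : forall x, 0 <= w x.
Hypothesis iw : mu.-integrable setT (EFin \o w).

Definition wprod n (z : n.-tuple X) : R := \prod_(i < n) w (tnth z i).

Lemma wprod_ge0 n (z : n.-tuple X) : 0 <= wprod z.
Proof. by rewrite prodr_ge0. Qed.

Lemma wprod_consp n x (t : n.-tuple X) : wprod (consp (x, t)) = w x * wprod t.
Proof.
rewrite /wprod big_ord_recl (tnth_nth x)/=; congr (_ * _).
by apply: eq_bigr => i _; rewrite tnthS.
Qed.

Lemma measurable_wprod n : measurable_fun setT (@wprod n).
Proof.
rewrite /wprod; elim: (index_enum _) => [|i r ih].
  rewrite (_ : (fun z => _) = fun=> 1); first exact: measurable_cst.
  by apply/funext => z; rewrite big_nil.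
rewrite (_ : (fun z => _) = fun z : n.-tuple X => w (tnth z i) * \prod_(j <- r) w (tnth z j)).
  apply: measurable_funM => //.
  by apply: (measurableT_comp mw); exact: measurable_tnth.
by apply/funext => z; rewrite big_cons.
Qed.

Lemma integrable_wprod n : (mpow mu n).-integrable setT (EFin \o @wprod n).
Proof.
elim: n => [|n ih].
  apply/integrableP; split; first by apply/measurable_EFinP; exact: measurable_wprod.
  rewrite integral_dirac//.
    by rewrite diracT mul1e ltry.
  apply: measurableT_comp => //.
  by apply/measurable_EFinP; exact: measurable_wprod.
rewrite (_ : _ \o _ = fun z => (w (thead z) * wprod (tbehead z))%:E).
  by apply: integrable_tensor => // z; exact: wprod_ge0.
apply/funext => z /=.
rewrite [z in LHS](_ : _ = consp (thead z, tbehead z)) ?wprod_consp//.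
by rewrite [LHS]tuple_eta; exact/val_inj.
Qed.

End weight.

(** * Permutations of particles *)

Section particle_permutations.
Context (R : realType) d (X : measurableType d).
Variable q : X -> X -> R[i].

(** Invariance is required at every point, which spares an exceptional null set whenever a function
    is permuted or one of its arguments is frozen. *)
Definition Qsymmetric n (F : n.-tuple X -> R[i]) :=
  forall (s : 'S_n) z, Psi q s F z = F z.

Lemma permt_lift0 n (s : 'S_n) x (t : n.-tuple X) :
  permt (lift_perm ord0 ord0 s) (consp (x, t)) = consp (x, permt s t).
Proof.
apply: eq_from_tnth => i; rewrite tnth_mktuple.
have [j ->|->] := unliftP ord0 i; last by rewrite lift_perm_id !(tnth_nth x).
by rewrite lift_perm_lift !tnthS tnth_mktuple.
Qed.

(** No inverted pair contains the first particle, which therefore contributes no factor. *)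
Lemma Qperm_lift0 n (s : 'S_n) x (t : n.-tuple X) :
  Qperm q (lift_perm ord0 ord0 s) (consp (x, t)) = Qperm q s t.
Proof.
rewrite /Qperm lift_permV big_ord_recl big1 ?mul1r => [|j /andP[_]]; last first.
  by rewrite lift_perm_id.
apply: eq_bigr => i _; rewrite big_mkcond big_ord_recl/= mul1r [RHS]big_mkcond.
apply: eq_bigr => j _; rewrite !lift_perm_lift !tnthS.
by rewrite !(lift0, ltnS).
Qed.

Lemma Psi_lift0 n (s : 'S_n) F x (t : n.-tuple X) :
  Psi q (lift_perm ord0 ord0 s) F (consp (x, t)) =
  Psi q s (fun t => F (consp (x, t))) t.
Proof. by rewrite /Psi Qperm_lift0 permt_lift0. Qed.

Definition tdrop n (i : 'I_n.+1) (z : n.+1.-tuple X) : n.-tuple X :=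
  [tuple tnth z (lift i k) | k < n].

Lemma permt_lift1 n (i : 'I_n.+1) (z : n.+1.-tuple X) :
  permt (lift_perm ord0 i 1%g) z = consp (tnth z i, tdrop i z).
Proof.
apply: eq_from_tnth => k; rewrite tnth_mktuple.
have [j ->|->] := unliftP ord0 k; last by rewrite lift_perm_id (tnth_nth (tnth z i)).
by rewrite lift_perm_lift perm1 tnthS tnth_mktuple.
Qed.

(** This permutation brings particle [i] to the front and keeps the others in order, so it inverts
    exactly the pairs (a, i) with a < i. *)
Lemma Qperm_lift1 n (i : 'I_n.+1) (z : n.+1.-tuple X) :
  Qperm q (lift_perm ord0 i 1%g) z =
  \prod_(a < n.+1 | (a < i)%N) q (tnth z a) (tnth z i).
Proof.
rewrite /Qperm lift_permV invg1 [RHS]big_mkcond/=; apply: eq_bigr => a _.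
have [ai|ia] := ltnP a i.
  rewrite (big_pred1 i)// => b /=.
  have [k eb|->] := unliftP i b; last first.
    rewrite eqxx ai lift_perm_id; have [l ->|ea] := unliftP i a.
      by rewrite lift_perm_lift lift0.
    by rewrite ea ltnn in ai.
  rewrite eb eq_sym (negbTE (neq_lift _ _)).
  have [l ea|ea] := unliftP i a; last by rewrite ea ltnn in ai.
  rewrite ea !lift_perm_lift !perm1 /= /bump/=; apply/negbTE; lia.
rewrite big1// => b /andP[ab].
have [l ea|->] := unliftP i a; last by rewrite lift_perm_id.
have [k eb|eb] := unliftP i b; last by exfalso; move: ab; rewrite eb; lia.
rewrite ea eb !lift_perm_lift !perm1 => h; exfalso; move: ab h.
by rewrite ea eb /= /bump; lia.
Qed.

Lemma tensor_consp n (h : X -> R) (F : n.-tuple X -> R[i]) x t :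
  tensor h F (consp (x, t)) = (h x)%:C * F t.
Proof. by rewrite /tensor theadE; congr (_ * F _); exact/val_inj. Qed.

Hypothesis qN : forall x y, q x y * q y x = 1.

Lemma symPE n (F : n.-tuple X -> R[i]) : Qsymmetric F -> symP q F = F.
Proof.
move=> symF; apply/funext => z; rewrite /symP.
under eq_bigr do rewrite symF.
rewrite sumr_const (_ : #|_| = n`!); last by rewrite -card_Sn; apply: eq_card.
by rewrite -[F z *+ _]mulr_natl mulKf// pnatr_eq0 -lt0n fact_gt0.
Qed.

Lemma Qsymmetric_symP n (F : n.-tuple X -> R[i]) : Qsymmetric (symP q F).
Proof.
move=> t z; rewrite /symP {1}/Psi mulrCA mulr_sumr; congr (_ * _).
rewrite [RHS](reindex_inj (mulIg t))/=; apply: eq_bigr => s _.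
by rewrite -PsiM.
Qed.

Lemma QsymmetricD n (F G : n.-tuple X -> R[i]) :
  Qsymmetric F -> Qsymmetric G -> Qsymmetric (fun z => F z + G z).
Proof. by move=> hF hG s z; rewrite /Psi mulrDr -/(Psi q s F z) -/(Psi q s G z) hF hG. Qed.

(** The permutations split into cosets of the stabiliser of the first index. The stabiliser fixes
    [tensor h F] because [F] is symmetric, so each coset contributes n! equal terms, and n!/(n+1)!
    leaves 1/(n+1). *)
Lemma symP_tensor n (h : X -> R) (F : n.-tuple X -> R[i]) (z : n.+1.-tuple X) :
  Qsymmetric F ->
  symP q (tensor h F) z = (n.+1%:R)^-1 * \sum_(i < n.+1)
    (\prod_(a < n.+1 | (a < i)%N) q (tnth z a) (tnth z i)) *
    ((h (tnth z i))%:C * F (tdrop i z)).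
Proof.
move=> symF; rewrite /symP.
have hE s : Psi q (lift_perm ord0 ord0 s) (tensor h F) = tensor h F.
  apply/funext => y; rewrite [y](_ : _ = consp (thead y, tbehead y)); last first.
    by rewrite [LHS]tuple_eta; exact/val_inj.
  by rewrite Psi_lift0 /Psi !tensor_consp mulrCA -/(Psi q s F _) symF.
(* The image of the first index and the rearrangement of the rest determine a permutation; counting
   turns injectivity into bijectivity. *)
pose phi (p : 'I_n.+1 * 'S_n) := lift_perm ord0 p.1 p.2.
have phi_inj : injective phi.
  move=> [i s] [j t] /permP st; have := st ord0.
  rewrite /phi !lift_perm_id/= => ij; rewrite ij in st *; congr (_, _).
  apply/permP => k; have := st (lift ord0 k); rewrite /phi/= !lift_perm_lift.
  exact: lift_inj.
have cardS k : #|{: 'S_k}| = k`! by rewrite -card_Sn; apply: eq_card.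
have phi_bij : bijective phi.
  apply: inj_card_bij => //; rewrite card_prod card_ord.
  by rewrite !cardS factS.
rewrite (reindex phi) /=; last exact/onW_bij.
rewrite -(pair_bigA _ (fun i s => Psi q (lift_perm ord0 i s) (tensor h F) z))/=.
rewrite factS natrM invfM -mulrA; congr (_ * _).
rewrite mulr_sumr; apply: eq_bigr => i _.
have -> : \sum_(s : 'S_n) Psi q (lift_perm ord0 i s) (tensor h F) z =
    n`!%:R * Psi q (lift_perm ord0 i 1%g) (tensor h F) z.
  under eq_bigr => s _.
    rewrite -[s in lift_perm _ _ s]mulg1 -(lift_permM ord0 ord0 i) -PsiM// hE.
    over.
  rewrite sumr_const -[LHS]mulr_natl; congr (_%:R * _).
  exact: cardS.
rewrite mulKf ?pnatr_eq0 -?lt0n ?fact_gt0// /Psi Qperm_lift1 permt_lift1.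
by rewrite tensor_consp.
Qed.

End particle_permutations.

(** * An invariant domain *)

Section domain.
Context (R : realType) d (X : measurableType d).
Variables (mu : {sigma_finite_measure set X -> \bar R}) (q : X -> X -> R[i]).
Variable w : X -> R.
Hypothesis qN : forall x y, q x y * q y x = 1.
Hypothesis qJ : forall x y, q x y = (q y x)^*.
Hypothesis mq : measurable_cfun setT (fun p : X * X => q p.1 p.2).
Hypothesis mw : measurable_fun setT w.
Hypothesis w01 : forall x, w x = 0 \/ 1 <= w x.
Hypothesis iw : forall N, mu.-integrable setT (EFin \o (fun x => w x ^+ N.+1)).

Implicit Types (h : X -> R).

(** The exponent is kept positive: the power 0 would be the constant 1, which need not be
    integrable. *)
Definition wbounded n (F : n.-tuple X -> R[i]) :=
  exists C N, 0 <= C /\ forall z, normc (F z) <= C * wprod w z ^+ N.+1.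

Definition good n (F : n.-tuple X -> R[i]) :=
  [/\ measurable_cfun setT F, Qsymmetric q F & wbounded F].

Definition good_fock (F : fockseq R X) :=
  (forall n, good (F n)) /\
  exists M, forall n, (M <= n)%N -> F n = fun=> 0.

(** One power of [w] is meant to dominate both f(t) and f(t)x, the two functions that enter a
    field. *)
Definition wtest h := measurable_fun setT h /\
  exists2 C, 0 <= C & forall x, `|h x| <= C * w x.

(** The factor n+1 is the ratio (n+1)!/n! of the weights in the Fock inner product; [h] is real, so
    it appears without conjugation. *)
Definition annih h (F : fockseq R X) : fockseq R X := fun n t =>
  n.+1%:R * cintegral mu (fun x => (h x)%:C * F n.+1 (consp (x, t))).

Lemma w_ge0 x : 0 <= w x.
Proof. by case: (w01 x) => [->//|]; exact: le_trans. Qed.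
Local Hint Resolve w_ge0 : core.

Lemma normc_q x y : normc (q x y) = 1.
Proof.
have := congr1 (@normc R) (qN x y); rewrite normcM [q y x]qJ normcJ normc1 -expr2.
by move/eqP; rewrite sqrf_eq1 => /orP[/eqP//|/eqP n1]; have := normc_ge0 (q x y); rewrite n1; lra.
Qed.

Lemma normc_Qperm n (s : 'S_n) z : normc (Qperm q s z) = 1.
Proof.
by rewrite /Qperm normc_prod big1// => i _; rewrite normc_prod big1// => j _; exact: normc_q.
Qed.

Lemma normc_Psi n (s : 'S_n) F z : normc (Psi q s F z) = normc (F (permt s z)).
Proof. by rewrite /Psi normcM normc_Qperm mul1r. Qed.

Lemma wprod_permt n (s : 'S_n) (z : n.-tuple X) : wprod w (permt s z) = wprod w z.
Proof.
rewrite /wprod [RHS](reindex_inj (@perm_inj _ s))/=.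
by apply: eq_bigr => i _; rewrite tnth_mktuple.
Qed.

Lemma wprod01 n (z : n.-tuple X) : wprod w z = 0 \/ 1 <= wprod w z.
Proof.
rewrite /wprod; elim/big_rec : _ => [|i x _ [->|x1]]; [by right|by left; rewrite mulr0|].
case: (w01 (tnth z i)) => [->|w1]; first by left; rewrite mul0r.
by right; rewrite -[leLHS]mulr1 ler_pM.
Qed.

Lemma wprodX n (z : n.-tuple X) N :
  wprod w z ^+ N = wprod (fun x => w x ^+ N) z.
Proof. by rewrite /wprod prodrXl. Qed.

Lemma expr01_le (a : R) m N : a = 0 \/ 1 <= a -> (m <= N)%N -> a ^+ m.+1 <= a ^+ N.+1.
Proof. by move=> [->|a1] mN; [rewrite !expr0n|rewrite ler_weXn2l]. Qed.

(** If the product is nonzero, all its factors are at least 1, so each of them is at most the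
    product. *)
Lemma tnth_wprod_le n (z : n.-tuple X) (i : 'I_n) :
  w (tnth z i) * wprod w z <= wprod w z ^+ 2.
Proof.
have [->|w1] := wprod01 z; first by rewrite mulr0 expr0n.
rewrite expr2 ler_wpM2r ?wprod_ge0// /wprod (bigD1 i)//=.
have [-> | w1'] := w01 (tnth z i); first by rewrite mul0r.
rewrite ler_peMr//; move: w1; rewrite /wprod (bigD1 i)//= => w1.
have : \prod_(j < n | j != i) w (tnth z j) = 0 \/ 1 <= \prod_(j < n | j != i) w (tnth z j).
  elim/big_rec : _ => [|k x _ [->|x1]]; [by right|by left; rewrite mulr0|].
  case: (w01 (tnth z k)) => [->|wk1]; first by left; rewrite mul0r.
  by right; rewrite -[leLHS]mulr1 ler_pM.
by case=> // p0; move: w1; rewrite p0 mulr0 ler10.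
Qed.

Lemma integrable_wprodX n N :
  (mpow mu n).-integrable setT (EFin \o (fun z => wprod w z ^+ N.+1)).
Proof.
rewrite (_ : _ \o _ = EFin \o @wprod _ _ _ (fun x => w x ^+ N.+1) n).
  apply: integrable_wprod; last exact: iw.
  - exact: measurable_funX.
  - by move=> x; rewrite exprn_ge0.
by apply/funext => z /=; rewrite wprodX.
Qed.

Lemma consp_eta n (z : n.+1.-tuple X) : z = consp (thead z, tbehead z).
Proof. by rewrite [LHS]tuple_eta; exact/val_inj. Qed.

Lemma measurable_tensor h n (F : n.-tuple X -> R[i]) : measurable_fun setT h ->
  measurable_cfun setT F -> measurable_cfun setT (tensor h F).
Proof.
move=> mh mF; apply: measurable_cfunM.
  by apply: measurable_cfun_real; apply: (measurableT_comp mh); exact: measurable_tnth.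
by apply: (measurable_cfun_comp _ mF); exact: measurable_behead.
Qed.

Lemma measurable_Qperm n (s : 'S_n) : measurable_cfun setT (Qperm q s).
Proof.
apply: measurable_cfun_prod => i; apply: measurable_cfun_prod => j.
pose p (z : n.-tuple X) := (tnth z i, tnth z j).
apply: (measurable_cfun_comp (phi := p) _ mq).
by apply: measurable_fun_pair; exact: measurable_tnth.
Qed.

Lemma measurable_Psi n (s : 'S_n) F : measurable_cfun setT F ->
  measurable_cfun setT (Psi q s F).
Proof.
move=> mF; apply: measurable_cfunM; first exact: measurable_Qperm.
by apply: (measurable_cfun_comp _ mF); exact: measurable_permt.
Qed.

Lemma measurable_symP n (F : n.-tuple X -> R[i]) : measurable_cfun setT F ->
  measurable_cfun setT (symP q F).
Proof.
move=> mF; apply: measurable_cfunM; first exact: measurable_cfun_cst.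
by apply: measurable_cfun_sum => s; exact: measurable_Psi.
Qed.

(** Each [Psi] permutes the arguments up to a phase, so a permutation-invariant bound survives the
    averaging. *)
Lemma normc_symP_le n (F : n.-tuple X -> R[i]) (b : n.-tuple X -> R) :
  (forall (s : 'S_n) z, b (permt s z) = b z) -> (forall z, normc (F z) <= b z) ->
  forall z, normc (symP q F z) <= b z.
Proof.
move=> bE Fb z; rewrite /symP normcM normcV normc_nat.
rewrite ler_pdivrMl ?ltr0n ?fact_gt0// (le_trans (normc_sum_le _ _ _))//.
under eq_bigr do rewrite normc_Psi.
apply: (@le_trans _ _ (\sum_(s : 'S_n) b z)).
  by apply: ler_sum => s _; rewrite -(bE s).
rewrite sumr_const -[leLHS]mulr_natl (_ : #|_| = n`!)//.
by rewrite -card_Sn; apply: eq_card.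
Qed.

Lemma good0 n : good (fun _ : n.-tuple X => 0).
Proof.
split; first exact: measurable_cfun_cst.
- by move=> s z; rewrite /Psi mulr0.
- by exists 0, 0%N; split => // z; rewrite normc0 mul0r.
Qed.

Lemma wboundedD n (F G : n.-tuple X -> R[i]) : wbounded F -> wbounded G ->
  wbounded (fun z => F z + G z).
Proof.
move=> [C [N [C0 FC]]] [D [M [D0 GD]]].
exists (C + D), (maxn N M); split; first exact: addr_ge0.
move=> z; rewrite (le_trans (normcD_le _ _))// mulrDl lerD//.
- rewrite (le_trans (FC z))// ler_wpM2l// expr01_le ?leq_maxl//; exact: wprod01.
- rewrite (le_trans (GD z))// ler_wpM2l// expr01_le ?leq_maxr//; exact: wprod01.
Qed.

Lemma goodD n (F G : n.-tuple X -> R[i]) : good F -> good G ->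
  good (fun z => F z + G z).
Proof.
move=> [mF sF bF] [mG sG bG]; split.
- exact: measurable_cfunD.
- exact: QsymmetricD.
- exact: wboundedD.
Qed.

Lemma good_symP_tensor h n (F : n.-tuple X -> R[i]) : wtest h ->
  good F -> good (symP q (tensor h F)).
Proof.
move=> [mh [D D0 hD]] [mF _ [C [N [C0 FC]]]]; split.
- exact/measurable_symP/measurable_tensor.
- exact: Qsymmetric_symP.
exists (D * C), N; split; first exact: mulr_ge0.
apply: normc_symP_le => [s z|z]; first by rewrite wprod_permt.
rewrite [z]consp_eta tensor_consp wprod_consp normcM normcR exprMn mulrACA.
apply: ler_pM => //; first exact: normc_ge0.
rewrite (le_trans (hD _))// ler_wpM2l// -[leLHS]expr1.
exact: expr01_le.
Qed.

Lemma measurable_neutral h n (F : n.-tuple X -> R[i]) : measurable_fun setT h ->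
  measurable_cfun setT F ->
  measurable_cfun setT (fun z => (\sum_(i < n) h (tnth z i))%:C * F z).
Proof.
move=> mh mF; apply: measurable_cfunM => //; apply: measurable_cfun_real.
elim: (index_enum _) => [|i r ih].
  rewrite (_ : (fun z => _) = fun=> 0); first exact: measurable_cst.
  by apply/funext => z; rewrite big_nil.
rewrite (_ : (fun z => _) = fun z : n.-tuple X => h (tnth z i) + \sum_(j <- r) h (tnth z j)).
  apply: measurable_funD => //.
  by apply: (measurableT_comp mh); exact: measurable_tnth.
by apply/funext => z; rewrite big_cons.
Qed.

Lemma good_neutral h n (F : n.-tuple X -> R[i]) : wtest h -> good F ->
  good (fun z => (\sum_(i < n) h (tnth z i))%:C * F z).
Proof.
move=> [mh [D D0 hD]] [mF sF [C [N [C0 FC]]]]; split.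
- exact: measurable_neutral.
- move=> s z; rewrite /Psi mulrCA -/(Psi q s F z) sF; congr (_%:C * _).
  rewrite [RHS](reindex_inj (@perm_inj _ s))/=.
  by apply: eq_bigr => i _; rewrite tnth_mktuple.
(* Each of the n summands costs one factor w(z_i), which one more power of [wprod] absorbs. *)
exists (n%:R * D * C), N.+1; split; first by rewrite !mulr_ge0.
move=> z; rewrite normcM normcR.
rewrite (le_trans (ler_wpM2l _ (FC z)))// mulrCA.
rewrite [leRHS](_ : _ = C * (n%:R * (D * wprod w z ^+ N.+2))); last by ring.
rewrite ler_wpM2l// (le_trans (ler_wpM2r _ (ler_norm_sum _ _ _)))//.
  by rewrite exprn_ge0// wprod_ge0.
rewrite mulr_suml mulr_natl -[X in _ *+ X]card_ord -sumr_const ler_sum// => i _.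
rewrite exprS mulrA.
rewrite [leRHS](_ : _ = D * wprod w z ^+ 2 * wprod w z ^+ N); last by rewrite !exprS; ring.
rewrite ler_wpM2r ?exprn_ge0 ?wprod_ge0//.
rewrite (le_trans (ler_wpM2r _ (hD _))) ?wprod_ge0// -mulrA ler_wpM2l//.
exact: tnth_wprod_le.
Qed.

(** Separating the annihilated particle from the others makes the bound integrable in [x] for every
    [t] and leaves a bound of the same kind in [t]. *)
Lemma annih_bound h n (F : n.+1.-tuple X -> R[i]) : wtest h -> wbounded F ->
  exists C N, 0 <= C /\ forall x t, normc ((h x)%:C * F (consp (x, t))) <=
    C * (w x ^+ N.+1 * wprod w t ^+ N.+1).
Proof.
move=> [mh [D D0 hD]] [C [N [C0 FC]]]; exists (D * C), N.+1; split.
  exact: mulr_ge0.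
move=> x t; rewrite normcM normcR.
apply: (@le_trans _ _ ((D * w x) * (C * (w x ^+ N.+1 * wprod w t ^+ N.+1)))).
  apply: ler_pM => //; first exact: normc_ge0.
  by rewrite (le_trans (FC _))// wprod_consp exprMn.
rewrite [leLHS](_ : _ = D * C * (w x ^+ N.+2 * wprod w t ^+ N.+1)); last by rewrite !exprS; ring.
rewrite ler_wpM2l ?mulr_ge0// ler_wpM2l ?exprn_ge0//.
by apply: expr01_le => //; exact: wprod01.
Qed.

Lemma measurable_consp_l n (t : n.-tuple X) : measurable_fun setT (fun x : X => consp (x, t)).
Proof.
have := measurable_cons (@measurable_id _ X setT) (@measurable_cst _ _ X _ setT t).
exact.
Qed.

Lemma cintegrable_annih h n (F : n.+1.-tuple X -> R[i]) t : wtest h -> good F ->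
  cintegrable mu (fun x => (h x)%:C * F (consp (x, t))).
Proof.
move=> th [mF _ bF]; have [C [N [C0 Fb]]] := annih_bound th bF.
apply: (cintegrable_le (g := fun x => C * wprod w t ^+ N.+1 * w x ^+ N.+1)).
- apply: measurable_cfunM; first by apply: measurable_cfun_real; case: th.
  by apply: (measurable_cfun_comp _ mF); exact: measurable_consp_l.
- rewrite (_ : _ \o _ = fun x => (C * wprod w t ^+ N.+1)%:E * (w x ^+ N.+1)%:E)%E//.
  exact: integrableZl (iw N).
- by move=> x; rewrite -mulrA [X in C * X]mulrC; exact: Fb.
Qed.

Lemma good_annih h (F : fockseq R X) n : wtest h -> good (F n.+1) ->
  good (@annih h F n).
Proof.
move=> th gF; have [mF sF bF] := gF; have [C [N [C0 Fb]]] := annih_bound th bF.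
have ci t := cintegrable_annih t th gF.
split.
- apply: measurable_cfunM; first exact: measurable_cfun_cst.
  apply: (@measurable_cintegral_consp _ _ _ mu n
    (fun z => (h (thead z))%:C * F n.+1 z)).
  apply: (cintegrable_le (g := fun z => C * wprod w z ^+ N.+1)).
  + apply: measurable_cfunM => //; apply: measurable_cfun_real; case: th => mh _.
    by apply: (measurableT_comp mh); exact: measurable_tnth.
  + exact: integrableZl (integrable_wprodX n.+1 N).
  + move=> z; rewrite [z in leLHS]consp_eta [z in leRHS]consp_eta theadE.
    by rewrite wprod_consp exprMn; exact: Fb.
(* Symmetry in the remaining particles is the symmetry of [F] under permutations that fix the
   integrated one. *)
- move=> s t; rewrite /Psi /annih mulrCA; congr (_ * _); rewrite -cintegralZ//.
  congr cintegral; apply/funext => x.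
  by rewrite mulrCA -(Qperm_lift0 q s x) -permt_lift0; congr (_ * _); exact: sF.
exists (n.+1%:R * (2 * (C * (\int[mu]_x (w x ^+ N.+1))%R))), N; split.
  do 3 rewrite mulr_ge0//; apply: Rintegral_ge0 => x _; exact: exprn_ge0.
move=> t; rewrite /annih normcM normc_nat -mulrA ler_wpM2l//.
have ig : mu.-integrable setT (EFin \o (fun x => C * wprod w t ^+ N.+1 * w x ^+ N.+1)).
  rewrite (_ : _ \o _ = fun x => (C * wprod w t ^+ N.+1)%:E * (w x ^+ N.+1)%:E)%E//.
  exact: integrableZl (iw N).
rewrite (le_trans (normc_cintegral_le (ci t) ig _))//.
  by move=> x; rewrite -mulrA [X in C * X]mulrC; exact: Fb.
by rewrite RintegralZl// -!mulrA [X in C * X]mulrC.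
Qed.

(** The arguments [h0] and [h1] stand for f(t) and f(t)x. With an integral in place of the chosen
    adjoint, the field can be evaluated at single configurations. *)
Definition xi_explicit h0 h1 (F : fockseq R X) : fockseq R X :=
  fock_add (fock_add (creation q h0 F) (neutral h1 F)) (annih h0 F).

Lemma good_fock_creation h F : wtest h -> good_fock F -> good_fock (creation q h F).
Proof.
move=> th [gF [M FM]]; split; first by case=> [|n]; [exact: good0|exact: good_symP_tensor].
exists M.+1; case=> // n nM; rewrite /creation FM//; apply/funext => z.
rewrite /symP big1 ?mulr0// => s _; by rewrite /Psi /tensor !mulr0.
Qed.

Lemma good_fock_neutral h F : wtest h -> good_fock F -> good_fock (neutral h F).
Proof.
move=> th [gF [M FM]]; split; first by move=> n; exact: good_neutral.
by exists M => n nM; rewrite /neutral FM//; apply/funext => z; rewrite mulr0.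
Qed.

Lemma good_fock_annih h F : wtest h -> good_fock F -> good_fock (annih h F).
Proof.
move=> th [gF [M FM]]; split; first by move=> n; exact: good_annih.
exists M => n nM; rewrite /annih FM ?(leqW nM)//; apply/funext => z.
rewrite (_ : (fun x => _) = fun=> 0) ?cintegral0 ?mulr0//.
by apply/funext => x; rewrite mulr0.
Qed.

Lemma good_fock_add F G : good_fock F -> good_fock G -> good_fock (fock_add F G).
Proof.
move=> [gF [M FM]] [gG [N GN]]; split; first by move=> n; exact: goodD.
exists (maxn M N) => n; rewrite geq_max => /andP[nM nN].
by rewrite /fock_add FM// GN//; apply/funext => z; rewrite addr0.
Qed.

Lemma good_fock_xi h0 h1 F : wtest h0 -> wtest h1 -> good_fock F ->
  good_fock (xi_explicit h0 h1 F).
Proof.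
move=> t0 t1 gF; apply: good_fock_add; last exact: good_fock_annih.
by apply: good_fock_add; [exact: good_fock_creation|exact: good_fock_neutral].
Qed.

Lemma good_fock_vacuum : good_fock (@vacuum R _ X).
Proof.
split; last by exists 1%N; case=> // n _; apply/funext => z.
case=> [|n]; last exact: good0.
split; first exact: measurable_cfun_cst.
- by move=> s z; rewrite /Psi /Qperm big_ord0 mul1r.
- exists 1, 0%N; split => // z; rewrite /vacuum eqxx normc1 mul1r.
  by rewrite /wprod big_ord0 expr1n.
Qed.

End domain.

(** * Square-integrable functions and Fock inner products *)

Section square_integrable.
Context (R : realType) d (X : measurableType d).
Variable mu : {measure set X -> \bar R}.
Implicit Types F G : X -> R[i].

Lemma L2P F : L2 mu F <-> measurable_cfun setT F /\
  mu.-integrable setT (EFin \o (fun x => normc (F x) ^+ 2)).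
Proof.
have E : (EFin \o (fun x => normc (F x) ^+ 2)) =
    fun x => (complex.Re (F x) ^+ 2 + complex.Im (F x) ^+ 2)%:E.
  by apply/funext => x/=; rewrite sqr_normc.
have absE : (\int[mu]_x `|(complex.Re (F x) ^+ 2 + complex.Im (F x) ^+ 2)%:E| =
             sqnorm mu F)%E.
  by apply: eq_integral => x _; rewrite gee0_abs// lee_fin addr_ge0 ?sqr_ge0.
split=> [[mF Foo]|[mF /integrableP[_]]]; last by rewrite E absE.
split=> //; apply/integrableP; split; last by rewrite E absE.
rewrite E; apply/measurable_EFinP; case: mF => F1 F2.
by apply: measurable_funD; exact: measurable_funX.
Qed.

Lemma L2_cintegrableM F G : L2 mu F -> L2 mu G ->
  cintegrable mu (fun x => F x * (G x)^*).
Proof.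
move=> /L2P[mF iF] /L2P[mG iG].
apply: (cintegrable_le (g := fun x => normc (F x) ^+ 2 + normc (G x) ^+ 2)).
- by apply: measurable_cfunM => //; exact: measurable_cfunJ.
- by apply: eq_integrable (integrableD _ iF iG).
- move=> x; rewrite normcM normcJ.
  have := sqr_ge0 (normc (F x) - normc (G x)).
  by have := normc_ge0 (F x); have := normc_ge0 (G x); nra.
Qed.

Lemma L2_le F (g : X -> R) : measurable_cfun setT F ->
  mu.-integrable setT (EFin \o g) -> (forall x, normc (F x) ^+ 2 <= g x) -> L2 mu F.
Proof.
move=> mF ig Fg; apply/L2P; split => //.
have E : (EFin \o (fun x => normc (F x) ^+ 2)) =
    EFin \o fun x => (complex.Re (F x) ^+ 2 + complex.Im (F x) ^+ 2).
  by apply/funext => x/=; rewrite sqr_normc.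
apply: (le_integrable _ _ _ ig) => //.
  rewrite E; apply/measurable_EFinP; case: mF => F1 F2.
  by apply: measurable_funD; exact: measurable_funX.
move=> x _; rewrite /= lee_fin ger0_norm ?sqr_ge0//.
by rewrite (le_trans (Fg x))// ler_norm.
Qed.

Lemma L2B F G : L2 mu F -> L2 mu G -> L2 mu (fun x => F x - G x).
Proof.
move=> /L2P[mF iF] /L2P[mG iG].
apply: (L2_le (g := fun x => 2 * normc (F x) ^+ 2 + 2 * normc (G x) ^+ 2)).
- by apply: measurable_cfunD => //; exact: measurable_cfunN.
- by apply: eq_integrable (integrableD _ (integrableZl _ 2 iF) (integrableZl _ 2 iG)).
- move=> x; have := normcD_le (F x) (- G x).
  have -> : normc (- G x) = normc (G x) by exact: normcN.
  have := sqr_ge0 (normc (F x) - normc (G x)).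
  by have := normc_ge0 (F x); have := normc_ge0 (G x); have := normc_ge0 (F x - G x); nra.
Qed.

Lemma L2_0 : L2 mu (fun=> 0).
Proof.
apply: (L2_le (g := fun=> 0)).
- exact: measurable_cfun_cst.
- exact: integrable0.
- by move=> x; rewrite normc0 expr0n.
Qed.

Lemma cinner_self_eq0 F : L2 mu F -> cinner mu F F = 0 ->
  \forall x \ae mu, F x = 0.
Proof.
move=> F2; have /L2P[mF iF] := F2; rewrite cinnerE => /(congr1 (@complex.Re R))/=.
rewrite (_ : (\int[mu]_x _)%R = (\int[mu]_x (normc (F x) ^+ 2))%R); last first.
  by apply: eq_Rintegral => x _; rewrite ReM ReJ ImJ sqr_normc; ring.
rewrite /Rintegral => F0.
have {F0} : (\int[mu]_x `|(EFin \o (fun x => normc (F x) ^+ 2)%R) x|)%E = 0%E.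
  transitivity (\int[mu]_x (normc (F x) ^+ 2)%:E)%E.
    by apply: eq_integral => x _; rewrite gee0_abs// lee_fin sqr_ge0.
  by rewrite -[LHS]fineK ?F0//; exact: integrable_fin_num.
move/(ae_eq_integral_abs mu measurableT (measurable_int _ iF)).
apply: filterS => x /(_ I) [] /eqP; rewrite sqrf_eq0 => /eqP; exact: eq0_normc.
Qed.

Lemma cinner_aer F G G' : measurable_cfun setT F -> measurable_cfun setT G ->
  measurable_cfun setT G' -> (\forall x \ae mu, G x = G' x) ->
  cinner mu F G = cinner mu F G'.
Proof.
move=> mF mG mG' GG'; rewrite !cinnerE; apply: cintegral_ae.
- by apply: measurable_cfunM => //; exact: measurable_cfunJ.
- by apply: measurable_cfunM => //; exact: measurable_cfunJ.
- by apply: filterS GG' => x ->.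
Qed.

Lemma cinner0r F : cinner mu F (fun=> 0) = 0.
Proof.
rewrite cinnerE (_ : (fun x => _) = fun=> 0) ?cintegral0//.
by apply/funext => x; rewrite rmorph0 mulr0.
Qed.

Lemma cinner0l F : cinner mu (fun=> 0) F = 0.
Proof.
rewrite cinnerE (_ : (fun x => _) = fun=> 0) ?cintegral0//.
by apply/funext => x; rewrite mul0r.
Qed.

End square_integrable.

Section fock_inner_finite.
Context (R : realType) d (X : measurableType d).
Variable mu : {sigma_finite_measure set X -> \bar R}.
Implicit Types F G : fockseq R X.

Lemma lim_series_finite (u : nat -> R) M : (forall n, (M <= n)%N -> u n = 0) ->
  limn (series u) = \sum_(0 <= n < M) u n.
Proof.
move=> u0; apply: (lim_near_cst (@Rhausdorff R)).
exists M => // N /= MN.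
rewrite /series/= (big_cat_nat (n := M))//= [X in _ + X]big_nat_cond.
by rewrite [X in _ + X]big1 ?addr0// => i /andP[/andP[Mi _] _]; exact: u0.
Qed.

Lemma fock_inner_finite F G M :
  (forall n, (M <= n)%N -> cinner (mpow mu n) (F n) (G n) = 0) ->
  fock_inner mu F G = \sum_(0 <= n < M) n`!%:R * cinner (mpow mu n) (F n) (G n).
Proof.
move=> FG0; apply/eqP; rewrite eq_complex; apply/andP; split; apply/eqP.
- rewrite /fock_inner/= (lim_series_finite (M := M)); last first.
    by move=> n Mn; rewrite FG0// mulr0.
  by elim/big_rec2 : _ => // n x y _ ->; rewrite ReD.
- rewrite /fock_inner/= (lim_series_finite (M := M)); last first.
    by move=> n Mn; rewrite FG0// mulr0.
  by elim/big_rec2 : _ => // n x y _ ->; rewrite ImD.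
Qed.

Lemma eq_fock_inner F G F' G' :
  (forall n, cinner (mpow mu n) (F n) (G n) = cinner (mpow mu n) (F' n) (G' n)) ->
  fock_inner mu F G = fock_inner mu F' G'.
Proof.
move=> h; rewrite /fock_inner; congr (limn (series _) +i* limn (series _));
  by apply/funext => n; rewrite h.
Qed.

(** Only degree 0 survives, and there the power measure is the Dirac mass at the empty tuple. *)
Lemma fock_inner_vacuum F : measurable_cfun setT (F 0%N) ->
  fock_inner mu F (@vacuum R _ X) = F 0%N [tuple].
Proof.
move=> [mRe mIm]; rewrite (fock_inner_finite (M := 1)); last first.
  by case=> // n _; exact: cinner0r.
rewrite big_nat1 mul1r cinnerE /cintegral /Rintegral /=.
have E (u : 0.-tuple X -> R) : measurable_fun setT u ->
    fine (\int[\d_([tuple] : 0.-tuple X)]_x (u x)%:E)%E = u [tuple].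
  by move=> mu'; rewrite integral_dirac ?diracT ?mul1e//; exact/measurable_EFinP.
have -> : (fun x => (complex.Re (F 0%N x * (vacuum R x)^*))%:E) =
    (fun x => (complex.Re (F 0%N x))%:E).
  by apply/funext => x; rewrite /vacuum eqxx rmorph1 mulr1.
have -> : (fun x => (complex.Im (F 0%N x * (vacuum R x)^*))%:E) =
    (fun x => (complex.Im (F 0%N x))%:E).
  by apply/funext => x; rewrite /vacuum eqxx rmorph1 mulr1.
by rewrite !E//; case: (F _ _).
Qed.

End fock_inner_finite.

(** * Annihilation *)

Section annihilation.
Context (R : realType) d (X : measurableType d).
Variables (mu : {sigma_finite_measure set X -> \bar R}) (q : X -> X -> R[i]).
Variable w : X -> R.
Hypothesis qN : forall x y, q x y * q y x = 1.
Hypothesis qJ : forall x y, q x y = (q y x)^*.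
Hypothesis mq : measurable_cfun setT (fun p : X * X => q p.1 p.2).
Hypothesis mw : measurable_fun setT w.
Hypothesis w01 : forall x, w x = 0 \/ 1 <= w x.
Hypothesis iw : forall N, mu.-integrable setT (EFin \o (fun x => w x ^+ N.+1)).

Implicit Types (h : X -> R) (F G H : fockseq R X).

Let w_ge0 := w_ge0 w01.

Lemma good_L2 n (F : n.-tuple X -> R[i]) : good q w F -> L2 (mpow mu n) F.
Proof.
move=> [mF _ [C [N [C0 FC]]]].
(* The exponent is 2(N+1), written as a successor to match the integrability of positive powers. *)
apply: (L2_le (g := fun z => C ^+ 2 * wprod w z ^+ (N.+1 + N).+1)) => //.
  by have := integrableZl measurableT (C ^+ 2) (integrable_wprodX mw w01 iw n (N.+1 + N)).
move=> z; rewrite (le_trans (lerXn2r 2 _ _ (FC z))) ?nnegrE ?normc_ge0//.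
  by rewrite mulr_ge0// exprn_ge0// wprod_ge0.
by rewrite exprMn -exprM muln2 doubleS -addnn.
Qed.

(** The symmetriser is self-adjoint: writing [F] as [Psi q s F] cancels the phase of each term, and
    invariance of the measure makes the n! remaining integrals equal. *)
Lemma cinner_symP n (F G : n.-tuple X -> R[i]) : Qsymmetric q F ->
  cintegrable (mpow mu n) (fun z => G z * (F z)^*) ->
  cinner (mpow mu n) (symP q G) F = cinner (mpow mu n) G F.
Proof.
move=> sF iGF; rewrite !cinnerE.
have -> : (fun z => symP q G z * (F z)^*) = fun z =>
    (n`!%:R)^-1 * \sum_(s : 'S_n) (G (permt s z) * (F (permt s z))^*).
  apply/funext => z; rewrite /symP -mulrA mulr_suml; congr (_ * _).
  apply: eq_bigr => s _; rewrite -[in LHS](sF s z) /Psi conjcM mulrACA.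
  by rewrite mulcJ_normc1 ?mul1r// (normc_Qperm qN qJ).
have ip s := cintegrable_permt s iGF.
rewrite cintegralZ; last exact: (cintegrable_sum _ ip).
rewrite (cintegral_sum _ ip).
under eq_bigr do rewrite (cintegral_permt _ iGF).
rewrite sumr_const (_ : #|_| = n`!); last by rewrite -card_Sn; apply: eq_card.
by rewrite -[cintegral _ _ *+ _]mulr_natl mulKf// pnatr_eq0 -lt0n fact_gt0.
Qed.

(** Here [G] is a component of an arbitrary test vector and only square-integrable, so its product
    with a power of the weight is dominated through ac <= a^2 + c^2. *)
Lemma cintegrable_tensorM h n (G : n.-tuple X -> R[i]) (F : n.+1.-tuple X -> R[i]) :
  wtest w h -> L2 (mpow mu n) G -> good q w F ->
  cintegrable (mpow mu n.+1) (fun z => tensor h G z * (F z)^*).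
Proof.
move=> th G2 [mF _ bF]; have /L2P[mG iG] := G2.
have [C [N [C0 Fb]]] := annih_bound w01 th bF.
pose b (t : n.-tuple X) := normc (G t) ^+ 2 + wprod w t ^+ (N.+1 + N).+1.
have b0 t : 0 <= b t by rewrite addr_ge0 ?sqr_ge0// exprn_ge0// wprod_ge0.
have ib : (mpow mu n).-integrable setT (EFin \o b).
  by have := integrableD measurableT iG (integrable_wprodX mw w01 iw n (N.+1 + N)).
have wN0 x : 0 <= w x ^+ N.+1 by rewrite exprn_ge0.
have := integrable_tensor wN0 b0 (iw N) ib.
move=> /(integrableZl measurableT C) iab.
apply: (cintegrable_le (g := fun z => C * (w (thead z) ^+ N.+1 * b (tbehead z)))) => //.
  apply: measurable_cfunM; last exact: measurable_cfunJ.
  by apply: measurable_tensor => //; case: th.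
move=> z; rewrite [z]consp_eta tensor_consp theadE tbehead_consp.
set x := thead z; set t := tbehead z.
rewrite normcM normcJ normcM mulrAC -normcM.
rewrite (le_trans (ler_wpM2r (normc_ge0 _) (Fb x t)))// -!mulrA ler_wpM2l// ler_wpM2l//.
rewrite /b addSn addnn -doubleS -muln2 exprM.
set a := normc (G t); set c := wprod w t ^+ N.+1.
have a0 : 0 <= a by exact: normc_ge0.
have c0 : 0 <= c by rewrite exprn_ge0// wprod_ge0.
by have := sqr_ge0 (a - c); nra.
Qed.

(** Once [cinner_symP] has removed the symmetriser, this is Fubini in the first particle. *)
Lemma cinner_creation h (H F : fockseq R X) n : wtest w h ->
  L2 (mpow mu n) (H n) -> good q w (F n.+1) ->
  n.+1%:R * cinner (mpow mu n.+1) (@creation _ _ _ q h H n.+1) (F n.+1) =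
  cinner (mpow mu n) (H n) (@annih _ _ _ mu h F n).
Proof.
move=> th H2 gF; have [mF sF bF] := gF.
have iY := cintegrable_tensorM th H2 gF.
rewrite /= cinner_symP// cinnerE.
have ia t := cintegrable_annih w01 iw t th gF.
have E t : (fun x => tensor h (H n) (consp (x, t)) * (F n.+1 (consp (x, t)))^*) =
    fun x => H n t * ((h x)%:C * F n.+1 (consp (x, t)))^*.
  by apply/funext => x; rewrite tensor_consp conjcM conjc_realC mulrAC mulrC.
have iaJ t : cintegrable mu (fun x => ((h x)%:C * F n.+1 (consp (x, t)))^*).
  have [I1 I2] := ia t; split.
    by under [X in EFin \o X]eq_fun do rewrite ReJ.
  under [X in EFin \o X]eq_fun do rewrite ImJ.
  exact: (integrableN I2).
rewrite cintegral_mpowS//; last by move=> t; rewrite E; exact: cintegrableZ.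
rewrite -cintegralZ.
  congr cintegral; apply/funext => t; rewrite E cintegralZ// cintegralJ//.
  by rewrite /annih conjcM conjc_natC mulrCA.
(* Up to the factor n+1 the partially integrated function is [H n] times the conjugate of the
   annihilated vector, a product of two square-integrable functions. *)
have := cintegrableZ (n.+1%:R^-1) (L2_cintegrableM H2 (good_L2 (good_annih mw w01 iw th gF))).
congr cintegrable; apply/funext => t; rewrite E cintegralZ// cintegralJ// /annih.
by rewrite conjcM conjc_natC mulrCA mulKf// pnatr_eq0.
Qed.

Lemma fock_inner_creation h H F : wtest w h ->
  (forall n, L2 (mpow mu n) (H n)) -> good_fock q w F ->
  fock_inner mu (creation q h H) F = fock_inner mu H (annih mu h F).
Proof.
move=> th H2 gF; have [_ [M1 aM1]] := good_fock_annih mw w01 iw th gF.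
have [gFn [M2 FM2]] := gF; pose M := maxn M1 M2.
rewrite (fock_inner_finite (M := M.+1)); last first.
  move=> n Mn; rewrite FM2 ?cinner0r// (leq_trans _ Mn)//.
  by rewrite leqW// leq_maxr.
rewrite (fock_inner_finite (M := M)); last first.
  by move=> n Mn; rewrite aM1 ?cinner0r// (leq_trans _ Mn)// leq_maxl.
(* Creation has no component of degree 0, so the two sums match after a shift by one degree. *)
rewrite big_nat_recl//= cinner0l mulr0 add0r.
apply: eq_bigr => n _; rewrite factS mulnC natrM -mulrA.
by rewrite (cinner_creation th (H2 n) (gFn n.+1)).
Qed.

(** Measurability of [F] is recorded because equality almost everywhere does not transfer it from
    [G], and comparing integrals requires it on both sides. *)
Definition fock_ae F G := forall n, measurable_cfun setT (F n) /\
  \forall z \ae mpow mu n, F n z = G n z.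

Lemma good_sym_space n (F : n.-tuple X -> R[i]) : good q w F -> sym_space mu q F.
Proof.
move=> gF; have F2 := good_L2 gF; split => //; exists F => //.
by apply: aeW => z; rewrite symPE//; case: gF.
Qed.

Lemma good_fockP F : good_fock q w F -> fock mu q F.
Proof.
move=> [gF [M FM]]; split; first by move=> n; exact/good_sym_space.
rewrite (nneseries_split 0 M); last first.
  move=> k _; rewrite mule_ge0 ?lee_fin// integral_ge0// => x _.
  by rewrite lee_fin addr_ge0 ?sqr_ge0.
rewrite eseries0 ?adde0; last first.
  move=> k; rewrite add0n => Mk _; rewrite FM//.
  rewrite /sqnorm; under eq_integral do rewrite /= expr0n/= addr0.
  by rewrite integral0 mule0.
apply: lte_sum_pinfty => n _; rewrite lte_mul_pinfty ?lee_fin//.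
by have [_] := good_L2 (gF n).
Qed.

(* Testing adjointness against the single-degree vector G n - G' n itself. *)
Lemma fock_adjoint_unique G G' :
  fock mu q G -> fock mu q G' ->
  (forall H, finite_fock mu q H -> fock_inner mu H G = fock_inner mu H G') ->
  forall n, \forall z \ae mpow mu n, G n z = G' n z.
Proof.
move=> [sG _] [sG' _] GG' n.
pose H : fockseq R X := fun k z => (k == n)%:R * (G k z - G' k z).
have Hn : H n = fun z => G n z - G' n z.
  by apply/funext => z; rewrite /H eqxx mul1r.
have H0 k : k != n -> H k = fun=> 0.
  by move=> kn; apply/funext => z; rewrite /H (negbTE kn) mul0r.
have [[G2 [G1 G12 GE]] [G2' [G1' G12' GE']]] := (sG n, sG' n).
have H2 : L2 (mpow mu n) (H n) by rewrite Hn; exact: L2B.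
have fH : finite_fock mu q H.
  split; last by exists n => k nk; apply: aeW => z; rewrite H0// gtn_eqF.
  move=> k; have [->|kn] := eqVneq k n.
    split => //; exists (fun z => G1 z - G1' z); first exact: L2B.
    rewrite Hn; apply: filterS2 GE GE' => z -> ->.
    rewrite /symP -mulrBr -sumrB; congr (_ * _); apply: eq_bigr => s _.
    by rewrite /Psi mulrBr.
  rewrite H0//; split; first exact: L2_0.
  exists (fun=> 0); first exact: L2_0.
  by apply: aeW => z; rewrite /symP big1 ?mulr0// => s _; rewrite /Psi mulr0.
have innerE K : fock_inner mu H K = n`!%:R * cinner (mpow mu n) (H n) (K n).
  rewrite (fock_inner_finite (M := n.+1)); last first.
    by move=> k nk; rewrite H0 ?cinner0l// gtn_eqF.
  rewrite big_nat_recr//= big_nat_cond big1 ?add0r// => k /andP[/andP[_ kn] _].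
  by rewrite H0 ?cinner0l ?mulr0// ltn_eqF.
have := GG' _ fH; rewrite !innerE => /mulfI; rewrite pnatr_eq0 -lt0n fact_gt0 => /(_ isT).
move=> cE; have : cinner (mpow mu n) (H n) (H n) = 0.
  have iG := L2_cintegrableM H2 G2; have iG' := L2_cintegrableM H2 G2'.
  transitivity (cinner (mpow mu n) (H n) (G n) - cinner (mpow mu n) (H n) (G' n)).
    rewrite -mulN1r !cinnerE -cintegralZ// -cintegralD//; last exact: cintegrableZ.
    congr cintegral; apply/funext => z.
    by rewrite mulN1r -mulrBr -rmorphB/= {2}Hn.
  by rewrite cE subrr.
move/(cinner_self_eq0 H2); apply: filterS => z.
by rewrite Hn => /eqP; rewrite subr_eq0 => /eqP.
Qed.

(** Exceptional sets stay null under adding a particle and under the finitely many permutations of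
    the symmetriser. *)
Lemma fock_ae_creation h F F' : wtest w h -> fock_ae F F' ->
  fock_ae (creation q h F) (creation q h F').
Proof.
move=> [mh _] FF' [|n].
  by split; [exact: measurable_cfun_cst|exact: aeW].
have [mF aF] := FF' n; split; first exact/measurable_symP/measurable_tensor.
have tE : \forall z \ae mpow mu n.+1, tensor h (F n) z = tensor h (F' n) z.
  by apply: filterS (ae_behead aF) => z e; congr (_ * _).
have : \forall z \ae mpow mu n.+1, forall s,
    tensor h (F n) (permt s z) = tensor h (F' n) (permt s z).
  by apply: filter_forall => s; exact: ae_permt tE.
apply: filterS => z hz; congr (_ * _); apply: eq_bigr => s _.
by rewrite /Psi hz.
Qed.

Lemma fock_ae_neutral h F F' : wtest w h -> fock_ae F F' ->
  fock_ae (neutral h F) (neutral h F').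
Proof.
move=> [mh _] FF' n; have [mF aF] := FF' n; split.
  exact: measurable_neutral.
by apply: filterS aF => z e; rewrite /neutral e.
Qed.

Lemma fock_ae_add F F' G G' : fock_ae F F' -> fock_ae G G' ->
  fock_ae (fock_add F G) (fock_add F' G').
Proof.
move=> FF' GG' n; have [[mF aF] [mG aG]] := (FF' n, GG' n); split.
  exact: measurable_cfunD.
by apply: filterS2 aF aG => z e e'; rewrite /fock_add e e'.
Qed.

Lemma fock_ae_annihilation h F F' : wtest w h -> good_fock q w F' ->
  fock_ae F F' -> fock_ae (annihilation mu q h F) (annih mu h F').
Proof.
move=> th gF' FF'; have gD := good_fock_annih mw w01 iw th gF'.
pose S := [set G | fock mu q G /\ forall H, finite_fock mu q H ->
  fock_inner mu (creation q h H) F = fock_inner mu H G].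
have SD : S (annih mu h F').
  split; first exact: good_fockP.
  move=> H [sH _]; rewrite -fock_inner_creation//; last by move=> n; have [] := sH n.
  apply: eq_fock_inner => n; have [mF aF] := FF' n.
  apply: cinner_aer => //; last by have [[]] := gF'.1 n.
  case: n {mF aF} => [|n]; first exact: measurable_cfun_cst.
  apply: measurable_symP => //; apply: measurable_tensor; first by case: th.
  by have [[]] := sH n.
(* The explicit vector rules out the default value of [xget], so the chosen vector satisfies the
   adjoint relation as well. *)
have [fG adjG] : S (annihilation mu q h F) by apply: xgetPex; exists (annih mu h F').
have [fD adjD] := SD.
move=> n; split; first by have [[[]]] := fG.1 n.
apply: fock_adjoint_unique => // H fH.
by rewrite -adjG// adjD.
Qed.

End annihilation.

(** * Localisation of the fields *)

Section localization.
Context (R : realType) d (X : measurableType d).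
Variables (mu : {sigma_finite_measure set X -> \bar R}) (q : X -> X -> R[i]).
Variable w : X -> R.
Hypothesis qN : forall x y, q x y * q y x = 1.
Hypothesis qJ : forall x y, q x y = (q y x)^*.
Hypothesis mq : measurable_cfun setT (fun p : X * X => q p.1 p.2).
Hypothesis mw : measurable_fun setT w.
Hypothesis w01 : forall x, w x = 0 \/ 1 <= w x.
Hypothesis iw : forall N, mu.-integrable setT (EFin \o (fun x => w x ^+ N.+1)).

Implicit Types (h : X -> R) (F G u v : fockseq R X) (A B : set X).

Definition vanishes_off B h := forall x, ~ B x -> h x = 0.

Definition no_particle_in B F :=
  forall n (z : n.-tuple X) i, B (tnth z i) -> F n z = 0.

Lemma no_particle_in_creation B h F : (forall x, B x -> h x = 0) ->
  no_particle_in B F -> no_particle_in B (creation q h F).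
Proof.
move=> hB FB [|n] z i zB //=; rewrite /symP big1 ?mulr0// => s _.
rewrite /Psi; have : B (tnth (permt s z) (s^-1%g i)) by rewrite tnth_mktuple permKV.
move: (permt s z) (s^-1%g i) => y k; rewrite [y]consp_eta tensor_consp.
have [l ->|->] := unliftP ord0 k.
  by rewrite tnthS => /FB ->; rewrite !mulr0.
by rewrite (tnth_nth (thead y)) => /hB ->; rewrite mul0r mulr0.
Qed.

Lemma no_particle_in_xi B h0 h1 F : (forall x, B x -> h0 x = 0) ->
  no_particle_in B F -> no_particle_in B (xi_explicit mu q h0 h1 F).
Proof.
move=> hB FB n z i zB.
rewrite /xi_explicit /fock_add (no_particle_in_creation hB FB zB) add0r.
rewrite /neutral (FB _ _ _ zB) mulr0 add0r /annih.
rewrite (_ : (fun x => _) = fun=> 0) ?cintegral0 ?mulr0//.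
apply/funext => x; rewrite (FB _ _ (lift ord0 i)) ?mulr0//.
by rewrite tnthS.
Qed.

(** Configurations with a particle outside [A] are left free: there the g-fields may have put
    particles of their own. *)
Definition proportional_on A (c : R[i]) F G :=
  forall n (y : n.-tuple X), (forall i, A (tnth y i)) -> F n y = c * G n y.

Lemma proportional_on_creation A c h F G : proportional_on A c F G ->
  proportional_on A c (creation q h F) (creation q h G).
Proof.
move=> FG [|n] y yA; first by rewrite /= mulr0.
rewrite /= /symP mulrCA; congr (_ * _); rewrite mulr_sumr; apply: eq_bigr => s _.
rewrite /Psi [RHS]mulrCA; congr (_ * _).
have : forall i, A (tnth (permt s y) i) by move=> i; rewrite tnth_mktuple.
move: (permt s y) => z; rewrite [z]consp_eta; move: (thead z) (tbehead z) => x t tA.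
rewrite !tensor_consp [RHS]mulrCA FG// => i.
by have := tA (lift ord0 i); rewrite tnthS.
Qed.

(** The integrand vanishes unless the extra particle lies in [A], so [F] is read only where the
    proportionality is known. *)
Lemma proportional_on_annih A c h F G : wtest w h -> good_fock q w G ->
  vanishes_off A h -> proportional_on A c F G ->
  proportional_on A c (annih mu h F) (annih mu h G).
Proof.
move=> th [gG _] hA FG n y yA; rewrite /annih mulrCA; congr (_ * _).
rewrite -cintegralZ; last exact: (cintegrable_annih w01 iw).
congr cintegral; apply/funext => x.
have [xA|xA] := pselect (A x); last by rewrite hA// !mul0r mulr0.
rewrite mulrCA FG// => i; have [k ->|->] := unliftP ord0 i.
  by rewrite tnthS.
by rewrite (tnth_nth x).
Qed.

Lemma proportional_on_xi A c h0 h1 F G : wtest w h0 -> good_fock q w G ->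
  vanishes_off A h0 -> proportional_on A c F G ->
  proportional_on A c (xi_explicit mu q h0 h1 F) (xi_explicit mu q h0 h1 G).
Proof.
move=> th gG hA FG n y yA; rewrite /xi_explicit /fock_add !mulrDr.
rewrite (proportional_on_annih th gG hA FG)// (proportional_on_creation _ FG)//.
by rewrite /neutral FG// [_%:C * (c * _)]mulrCA.
Qed.

Definition tcat j l (z : j.-tuple X) (y : l.-tuple X) : (j + l).-tuple X :=
  [tuple of z ++ y].

(* The factorials make the relation invariant: up to them, [G] is the symmetrised
   tensor product of [u] and [v] when [u] lives on [B] and [v] on [A]. *)
Definition factorizes A B G u v :=
  forall j l (z : j.-tuple X) (y : l.-tuple X),
    (forall i, B (tnth z i)) -> (forall i, A (tnth y i)) ->
    (j + l)`!%:R * G (j + l)%N (tcat z y) = j`!%:R * l`!%:R * (u j z * v l y).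

Lemma creation_eq0 n h G (y : n.-tuple X) : (forall i, h (tnth y i) = 0) ->
  creation q h G y = 0.
Proof.
case: n y => // n y hy; rewrite /= /symP big1 ?mulr0// => s _.
have hs : h (thead (permt s y)) = 0 by rewrite /thead tnth_mktuple hy.
by rewrite /Psi [permt s y]consp_eta tensor_consp hs mul0r mulr0.
Qed.

Lemma tcat_consp j l x (z : j.-tuple X) (y : l.-tuple X) :
  consp (x, tcat z y) = tcat (consp (x, z)) y.
Proof. exact/val_inj. Qed.

Lemma tnth_tcat_l j l (z : j.-tuple X) (y : l.-tuple X) i :
  tnth (tcat z y) (lshift l i) = tnth z i.
Proof. exact: tnth_lshift. Qed.

Lemma tnth_tcat_r j l (z : j.-tuple X) (y : l.-tuple X) i :
  tnth (tcat z y) (rshift j i) = tnth y i.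
Proof. exact: tnth_rshift. Qed.

(** The ascriptions rely on [j.+1 + l] and [(j + l).+1] being convertible, which avoids casts
    between tuple types. *)
Lemma tdrop_tcat j l (z : j.+1.-tuple X) (y : l.-tuple X) (i : 'I_j.+1) :
  tdrop (lshift l i : 'I_(j + l).+1) (tcat z y : (j + l).+1.-tuple X) = tcat (tdrop i z) y.
Proof.
apply: eq_from_tnth => k; rewrite tnth_mktuple.
case: (split_ordP k) => k' ->.
  rewrite tnth_tcat_l tnth_mktuple.
  rewrite (_ : lift _ _ = lshift l (lift i k') :> 'I_(j.+1 + l)).
    exact: (tnth_tcat_l z y (lift i k')).
  exact/val_inj.
rewrite tnth_tcat_r.
rewrite (_ : lift _ _ = rshift j.+1 k' :> 'I_(j.+1 + l)).
  exact: (tnth_tcat_r z y k').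
apply/val_inj => /=; rewrite /bump; have := ltn_ord i; lia.
Qed.

(** In the expansion of [symP_tensor] the created particle occupies a position [i]. Positions in the
    [A] block contribute nothing, since [h] vanishes there; the others reproduce the expansion for
    [u]. The prefactors 1/(j+l+1) and 1/(j+1) reduce the factorials to those of the previous
    relation. *)
Lemma factorizes_creation A B h G u v : vanishes_off B h -> A `&` B = set0 ->
  good_fock q w G -> good_fock q w u -> factorizes A B G u v ->
  factorizes A B (creation q h G) (creation q h u) v.
Proof.
move=> hB AB [gG _] [gu _] Guv [|j] l z y zB yA.
  (* Without a [B] particle the created one would lie in [A], where [h] vanishes; on the right,
     creation has no component of degree 0. *)
  rewrite mul0r mulr0 (creation_eq0 (n := 0 + l)) ?mulr0// => i.
  apply: hB => iB; have : (A `&` B) (tnth y i); last by rewrite AB.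
  split => //; move: iB; rewrite (_ : tcat z y = y)//.
  by apply/val_inj; rewrite /= (tuple0 z).
rewrite [creation q h u]lock /= -lock /= !symP_tensor//; [|by case: (gu j)|by case: (gG (j + l)%N)].
rewrite (_ : (j.+1 + l)`! = (j + l).+1 * (j + l)`!)%N// factS !natrM.
rewrite mulrACA mulfV ?pnatr_eq0// mul1r.
set S := \sum_(i < j.+1) _.
rewrite [RHS](_ : _ = (j.+1%:R * j.+1%:R^-1) * (j`!%:R * l`!%:R * (S * v l y))); last by ring.
rewrite mulfV ?pnatr_eq0// mul1r.
rewrite (@big_split_ord _ _ _ j.+1 l) [X in _ * (_ + X)]big1 ?addr0; last first.
  move=> i _; rewrite (_ : h _ = 0) ?mul0r ?mulr0//; apply: hB.
  rewrite (tnth_tcat_r z y i) => iB.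
  have : (A `&` B) (tnth y i) by split.
  by rewrite AB.
rewrite mulr_suml !mulr_sumr; apply: eq_bigr => i _.
rewrite (tdrop_tcat z y i) (tnth_tcat_l z y i).
(* All positions before [i] belong to the [B] block, so the phase involves no particle of [A]. *)
have -> : \prod_(a < (j + l).+1 | (a < lshift l i)%N)
      q (tnth (tcat z y : (j + l).+1.-tuple X) a) (tnth z i) =
    \prod_(a < j.+1 | (a < i)%N) q (tnth z a) (tnth z i).
  rewrite (@big_split_ord _ _ _ j.+1 l)/= [X in _ * X]big_pred0 ?mulr1.
    by apply: eq_bigr => k _; rewrite (tnth_tcat_l z y).
  by move=> k /=; apply/negbTE; have := ltn_ord i; lia.
set P := \prod_(a < _ | _) _.
have zdB k : B (tnth (tdrop i z) k) by rewrite tnth_mktuple.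
rewrite [LHS](_ : _ = P * (h (tnth z i))%:C *
  ((j + l)`!%:R * G (j + l)%N (tcat (tdrop i z) y))); last by ring.
by rewrite Guv//; ring.
Qed.

Lemma factorizes_neutral A B h G u v : vanishes_off B h -> A `&` B = set0 ->
  factorizes A B G u v -> factorizes A B (neutral h G) (neutral h u) v.
Proof.
move=> hB AB Guv j l z y zB yA; rewrite /neutral big_split_ord/=.
rewrite [X in _ + X]big1 ?addr0; last first.
  move=> i _; apply: hB; rewrite tnth_tcat_r => iB.
  have : (A `&` B) (tnth y i) by split.
  by rewrite AB.
under eq_bigr do rewrite tnth_tcat_l.
by rewrite mulrCA Guv//; ring.
Qed.

(** Wherever the integrand is nonzero the extra particle lies in [B], and placing it in front keeps
    the [B] particles first. The factors j+l+1 and j+1 of the two annihilations complete the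
    factorials. *)
Lemma factorizes_annih A B h G u v : wtest w h -> vanishes_off B h ->
  good_fock q w G -> good_fock q w u -> factorizes A B G u v ->
  factorizes A B (annih mu h G) (annih mu h u) v.
Proof.
move=> th hB [gG _] [gu _] Guv j l z y zB yA; rewrite /annih.
have iG := cintegrable_annih w01 iw (tcat z y) th (gG _).
have iu := cintegrable_annih w01 iw z th (gu _).
rewrite mulrA -natrM mulnC -cintegralZ//.
rewrite [RHS](_ : _ = ((j.+1 * j`!)%:R * l`!%:R * v l y) *
    cintegral mu (fun x => (h x)%:C * u j.+1 (consp (x, z)))); last by rewrite natrM; ring.
rewrite -cintegralZ//; congr cintegral; apply/funext => x.
have [xB|xB] := pselect (B x); last by rewrite hB// !mul0r !mulr0.
have xzB i : B (tnth (consp (x, z)) i).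
  by have [k ->|->] := unliftP ord0 i; [rewrite tnthS|rewrite (tnth_nth x)].
rewrite mulrCA -!factS tcat_consp (Guv j.+1 l (consp (x, z)) y xzB yA).
by ring.
Qed.

Lemma factorizes_xi A B h0 h1 G u v : wtest w h0 -> vanishes_off B h0 ->
  vanishes_off B h1 -> A `&` B = set0 ->
  good_fock q w G -> good_fock q w u -> factorizes A B G u v ->
  factorizes A B (xi_explicit mu q h0 h1 G) (xi_explicit mu q h0 h1 u) v.
Proof.
move=> th h0B h1B AB gG gu Guv j l z y zB yA.
rewrite /xi_explicit /fock_add !mulrDr !mulrDl !mulrDr.
rewrite (factorizes_creation h0B AB gG gu Guv)//.
by rewrite (factorizes_neutral h1B AB Guv)// (factorizes_annih th h0B gG gu Guv).
Qed.

(** This starts the induction over the g-fields: as soon as a [B] particle is present, both sides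
    vanish. *)
Lemma factorizes_vacuum A B v : no_particle_in B v ->
  factorizes A B v (vacuum R (X := X)) v.
Proof.
move=> vB [|j] l z y zB yA.
  rewrite /vacuum eqxx !mul1r; congr (_ * v _ _).
  by apply/val_inj; rewrite /= (tuple0 z).
rewrite /vacuum !mul0r mulr0 (vB _ _ (lshift l ord0)) ?mulr0//.
by rewrite tnth_tcat_l.
Qed.

(** Taking j = 0 cancels the factorials; the scalar becomes the vacuum expectation of the g-fields
    when [u] is their action on the vacuum. *)
Lemma proportional_on_factorizes A B G u v : factorizes A B G u v ->
  proportional_on A (u 0%N [tuple]) G v.
Proof.
move=> Guv n y yA; have := Guv 0%N n [tuple] y.
rewrite mul1r => /(_ _ yA) h; apply: (@mulfI _ n`!%:R).
  by rewrite pnatr_eq0 -lt0n fact_gt0.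
rewrite -h; last by case.
by congr (_ * G _ _); apply/val_inj.
Qed.

End localization.

(** * Products of fields and their vacuum expectation *)

Section operator_products.
Context (R : realType) d (X : measurableType d).

(** Two families are allowed so that the lemma can both compare fields with their explicit versions
    and run one product on two vectors in parallel. *)
Lemma op_prod_rel (rel : fockseq R X -> fockseq R X -> Prop) n
    (p p' : 'I_n -> fockseq R X -> fockseq R X) F F' :
  (forall i F F', rel F F' -> rel (p i F) (p' i F')) ->
  rel F F' -> rel (op_prod p F) (op_prod p' F').
Proof.
move=> pp' FF'; rewrite /op_prod; elim: n p p' pp' => [|n ih] p p' pp'.
  by rewrite !big_ord0.
by rewrite !big_ord_recl /=; apply: (pp' ord0); apply: ih => i; exact: pp'.
Qed.

Lemma op_prod_ind (P : fockseq R X -> Prop) n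
    (p : 'I_n -> fockseq R X -> fockseq R X) F :
  (forall i F, P F -> P (p i F)) -> P F -> P (op_prod p F).
Proof. by move=> hp; apply: (@op_prod_rel (fun F _ => P F) _ p p F F) => i G _; exact: hp. Qed.

End operator_products.

Section vacuum_factorization.
Context (R : realType) d (X : measurableType d).
Variables (mu : {sigma_finite_measure set X -> \bar R}) (q : X -> X -> R[i]).
Variable w : X -> R.
Hypothesis qN : forall x y, q x y * q y x = 1.
Hypothesis qJ : forall x y, q x y = (q y x)^*.
Hypothesis mq : measurable_cfun setT (fun p : X * X => q p.1 p.2).
Hypothesis mw : measurable_fun setT w.
Hypothesis w01 : forall x, w x = 0 \/ 1 <= w x.
Hypothesis iw : forall N, mu.-integrable setT (EFin \o (fun x => w x ^+ N.+1)).

(** On an abstract one-particle space; with [xpow f 0] and [xpow f 1] as arguments it is convertible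
    to [xi mu q f]. *)
Definition xi_weak (h0 h1 : X -> R) (F : fockseq R X) : fockseq R X :=
  fock_add (fock_add (creation q h0 F) (neutral h1 F)) (annihilation mu q h0 F).

Lemma fock_ae_xi h0 h1 F F' : wtest w h0 -> wtest w h1 -> good_fock q w F' ->
  fock_ae mu F F' -> fock_ae mu (xi_weak h0 h1 F) (xi_explicit mu q h0 h1 F').
Proof.
move=> t0 t1 gF' FF'; apply: fock_ae_add.
  apply: fock_ae_add; first exact: fock_ae_creation t0 FF'.
  exact: fock_ae_neutral t1 FF'.
exact: (fock_ae_annihilation qN qJ mq mw w01 iw t0 gF' FF').
Qed.

(** The left vector contains the chosen adjoints; the right one is its explicit representative, used
    for pointwise computation. *)
Let rel F F' := fock_ae mu F F' /\ good_fock q w F'.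

Lemma vacuum_state_rel p F' : rel (p (vacuum R (X := X))) F' ->
  vacuum_state mu p = F' 0%N [tuple].
Proof.
move=> [FF' [gF' _]]; have [mF aF] := FF' 0%N.
transitivity (fock_inner mu F' (vacuum R (X := X))); last first.
  by apply: fock_inner_vacuum; have [] := gF' 0%N.
apply: eq_fock_inner => n; have [mFn aFn] := FF' n.
rewrite !cinnerE; have [mG _ _] := gF' n.
have mO : measurable_cfun setT (fun z : n.-tuple X => (vacuum R z)^*).
  exact: measurable_cfun_cst.
apply: cintegral_ae; [exact: measurable_cfunM|exact: measurable_cfunM|].
by apply: filterS aFn => z ->.
Qed.

Lemma vacuum_factorization (A B : set X) m k n
    (f0 f1 : 'I_(m + k) -> X -> R) (g0 g1 : 'I_n -> X -> R) :
  A `&` B = set0 ->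
  (forall i, wtest w (f0 i)) -> (forall i, wtest w (f1 i)) ->
  (forall j, wtest w (g0 j)) -> (forall j, wtest w (g1 j)) ->
  (forall i, vanishes_off A (f0 i)) ->
  (forall j, vanishes_off B (g0 j)) -> (forall j, vanishes_off B (g1 j)) ->
  let fs1 := op_prod (fun i => xi_weak (f0 (lshift k i)) (f1 (lshift k i))) in
  let fs2 := op_prod (fun i => xi_weak (f0 (rshift m i)) (f1 (rshift m i))) in
  let gs := op_prod (fun j => xi_weak (g0 j) (g1 j)) in
  vacuum_state mu (fs1 \o gs \o fs2) =
  vacuum_state mu (fs1 \o fs2) * vacuum_state mu gs.
Proof.
move=> AB tf0 tf1 tg0 tg1 f0A g0B g1B fs1 fs2 gs.
pose es1 := op_prod (fun i => xi_explicit mu q (f0 (lshift k i)) (f1 (lshift k i))).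
pose es2 := op_prod (fun i => xi_explicit mu q (f0 (rshift m i)) (f1 (rshift m i))).
pose egs := op_prod (fun j => xi_explicit mu q (g0 j) (g1 j)).
have step h0 h1 F F' : wtest w h0 -> wtest w h1 -> rel F F' ->
    rel (xi_weak h0 h1 F) (xi_explicit mu q h0 h1 F').
  move=> t0 t1 [FF' gF']; split; first exact: fock_ae_xi.
  exact: (good_fock_xi qN qJ mq mw w01 iw).
have r1 F F' : rel F F' -> rel (fs1 F) (es1 F').
  by move=> FF'; apply: op_prod_rel FF' => i F0 F0'; exact: step.
have r2 F F' : rel F F' -> rel (fs2 F) (es2 F').
  by move=> FF'; apply: op_prod_rel FF' => i F0 F0'; exact: step.
have rg F F' : rel F F' -> rel (gs F) (egs F').
  by move=> FF'; apply: op_prod_rel FF' => i F0 F0'; exact: step.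
pose O := vacuum R (X := X).
have rO : rel O O.
  split; last exact: good_fock_vacuum.
  by move=> i; split; [exact: measurable_cfun_cst|exact: aeW].
(* From here on each state is the value of an explicit vector at the empty configuration. *)
rewrite (vacuum_state_rel (r1 _ _ (rg _ _ (r2 _ _ rO)))).
rewrite (vacuum_state_rel (p := fs1 \o fs2) (r1 _ _ (r2 _ _ rO))).
rewrite (vacuum_state_rel (rg _ _ rO)) mulrC.
have gV : good_fock q w (es2 O) by have [] := r2 _ _ rO.
have VB : no_particle_in B (es2 O).
  apply: (@op_prod_ind _ _ _ (no_particle_in B)); last by case=> [z []|n0 z i _].
  move=> i F FB; apply: no_particle_in_xi FB => x Bx; apply: f0A => Ax.
  by have : (A `&` B) x by []; rewrite AB.
have : factorizes A B (egs (es2 O)) (egs O) (es2 O).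
  (* The same g-fields run on [es2 O] and on the vacuum; goodness of both vectors is carried along
     for the integrals in [annih]. *)
  pose P G u := [/\ good_fock q w G, good_fock q w u & factorizes A B G u (es2 O)].
  suff [] : P (egs (es2 O)) (egs O) by [].
  apply: (@op_prod_rel _ _ _ P) => [j G u [gG gu Gu]|].
    split; [exact: (good_fock_xi qN qJ mq mw w01 iw)|exact: (good_fock_xi qN qJ mq mw w01 iw)|].
    exact: (factorizes_xi qN w01 iw).
  split=> //; first exact: good_fock_vacuum.
  exact: factorizes_vacuum.
move/proportional_on_factorizes => GV.
suff /(_ 0%N [tuple]) : proportional_on A (egs O 0%N [tuple]) (es1 (egs (es2 O))) (es1 (es2 O)).
  by move=> e; apply: e => -[].
pose P F G := good_fock q w G /\ proportional_on A (egs O 0%N [tuple]) F G.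
suff [] : P (es1 (egs (es2 O))) (es1 (es2 O)) by [].
apply: (@op_prod_rel _ _ _ P) => // i F G [gG FG]; split.
  exact: (good_fock_xi qN qJ mq mw w01 iw).
exact: (proportional_on_xi w01 iw).
Qed.

End vacuum_factorization.

(** * Concrete weight and kernel *)

Section concrete_weight.
Context (R : realType) (T : ptopologicalType).

Lemma exp_moments_finite (nu : probability R R) (e : R) : 0 < e ->
  (\int[nu]_x (expR (e * `|x|))%:E < +oo)%E ->
  forall N, nu.-integrable setT (EFin \o (fun x => (1 + `|x|) ^+ N.+1)).
Proof.
move=> e0 eoo N.
(* With these constants c(1 + |x|) <= 1 + a|x| <= exp(a|x|), and the power N+1 turns the right-hand
   side into exp(e|x|). *)
pose a : R := e / N.+1%:R; pose c : R := Num.min 1 a.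
have a0 : 0 < a by rewrite divr_gt0.
have c0 : 0 < c by rewrite lt_min ltr01.
have m1 : measurable_fun setT (fun x : R => 1 + `|x|).
  by apply: measurable_funD; [exact: measurable_cst|exact: normr_measurable].
have ie : nu.-integrable setT (EFin \o (fun x => expR (e * `|x|))).
  apply/integrableP; split.
    apply/measurable_EFinP; apply: measurableT_comp => //.
    by apply: measurable_funM; [exact: measurable_cst|exact: normr_measurable].
  by under eq_integral do rewrite /= ger0_norm ?expR_ge0//.
have := integrableZl measurableT (c ^- N.+1) ie.
apply: le_integrable => //.
  by apply/measurable_EFinP; exact: measurable_funX.
move=> x _; rewrite /= lee_fin [leLHS]ger0_norm ?exprn_ge0 ?addr_ge0//.
rewrite [leRHS]ger0_norm ?mulr_ge0 ?expR_ge0 ?invr_ge0 ?exprn_ge0 ?(ltW c0)//.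
rewrite ler_pdivlMl ?exprn_gt0// -exprMn.
have -> : e * `|x| = (a * `|x|) * N.+1%:R by rewrite /a; field.
rewrite [a * _ * _]mulrC expRM_natl ler_pXn2r ?nnegrE ?mulr_ge0 ?expR_ge0 ?addr_ge0 ?(ltW c0)//.
apply: le_trans (expR_ge1Dx _); rewrite mulrDr mulr1 lerD ?ge_min ?lexx//.
by rewrite ler_wpM2r// ge_min lexx orbT.
Qed.

(** The summand 1 keeps the weight at least 1 over [K] and dominates x^0, while |x| dominates
    x^1. *)
Definition box_weight (K : set (borel T)) (z : phase T R) : R :=
  \1_K z.1 * (1 + `|z.2|).

Lemma measurable_box_weight K : measurable K -> measurable_fun setT (box_weight K).
Proof.
move=> mK; apply: measurable_funM.
  exact: (measurableT_comp (measurable_indic mK)).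
by apply: measurable_funD; [exact: measurable_cst|
  exact: (measurableT_comp (@normr_measurable R setT))].
Qed.

Lemma box_weight01 K z : box_weight K z = 0 \/ 1 <= box_weight K z.
Proof.
rewrite /box_weight indicE; case: (_ \in _); last by left; rewrite mul0r.
by right; rewrite mul1r lerDl.
Qed.

Lemma integrable_box_weight (s : {sigma_finite_measure set (borel T) -> \bar R})
    (nu : probability R R) K N : measurable K -> (s K < +oo)%E ->
  nu.-integrable setT (EFin \o (fun x => (1 + `|x|) ^+ N.+1)) ->
  (prod_measure s nu).-integrable setT (EFin \o (fun z => box_weight K z ^+ N.+1)).
Proof.
move=> mK Koo /integrableP[mN Noo].
have mw := measurable_box_weight mK.
apply/(integrable12ltyP s nu (f := EFin \o (fun z => box_weight K z ^+ N.+1))).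
  by apply/measurable_EFinP; exact: measurable_funX.
rewrite (_ : integral _ _ _ = \int[s]_x ((\1_K x)%:E * \int[nu]_y `|((1 + `|y|) ^+ N.+1)%:E|))%E.
  rewrite ge0_integralZr//.
  - by rewrite integral_indic// setIT lte_mul_pinfty// ge0_fin_numE.
  - by apply/measurable_EFinP; exact: measurable_indic.
  - exact: integral_ge0.
apply: eq_integral => x _; rewrite -ge0_integralZl//.
- apply: eq_integral => y _; rewrite /box_weight/= exprMn normrM EFinM.
  congr (_%:E * _)%E; rewrite indicE; case: (_ \in _); first by rewrite expr1n normr1.
  by rewrite expr0n normr0.
- exact: measurableT_comp.
Qed.

Lemma wtest_xpow (K : set (borel T)) (f : T -> R) k : (k <= 1)%N -> B0 f ->
  supp f `<=` K -> wtest (box_weight K) (xpow f k).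
Proof.
move=> k1 [mf [M fM] _] fK; split.
  apply: measurable_funM; first exact: (measurableT_comp mf).
  exact: measurable_funX.
exists `|M| => // z; rewrite /xpow normrM /box_weight indicE.
have [zK|zK] := boolP (z.1 \in K).
  rewrite mul1r ler_pM//; first by rewrite (le_trans (fM _))// ler_norm.
  by case: k k1 => [|[|//]] _; rewrite ?expr0 ?normr1 ?lerDl// expr1 lerDr.
rewrite (_ : f z.1 = 0) ?normr0 ?mul0r ?mulr0//.
apply/eqP; apply: contraNT zK => fz; apply/mem_set/fK; exact: subset_closure.
Qed.

Lemma vanishes_off_xpow (A : set T) (f : T -> R) k : supp f `<=` A ->
  vanishes_off [set z : phase T R | A z.1] (xpow f k).
Proof.
move=> fA z zA; rewrite /xpow (_ : f z.1 = 0) ?mul0r//.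
apply/eqP/negPn/negP => fz; apply: zA; apply: fA; exact: subset_closure.
Qed.

Lemma measurable_Qext (A : set (borel T * borel T)) (Q : T -> T -> R[i]) :
  measurable A -> measurable_cfun (~` A) (fun st => Q st.1 st.2) ->
  measurable_cfun setT (fun p : phase T R * phase T R => Qext A Q p.1 p.2).
Proof.
move=> mA [mRe mIm].
pose pr (p : phase T R * phase T R) : borel T * borel T := (p.1.1, p.2.1).
have mpr : measurable_fun setT pr.
  by apply: measurable_fun_pair; apply: measurableT_comp.
apply: (measurable_cfun_comp (phi := pr)
  (F := fun st => if st \in A then 1 else Q st.1 st.2) mpr).
have aux (u : borel T * borel T -> R) (c : R) : measurable_fun (~` A) u ->
    measurable_fun setT (fun st => if st \in A then c else u st).
  move=> mu; rewrite -(setUv A); apply/measurable_funU => //; first exact: measurableC.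
  split.
    apply: (eq_measurable_fun (fun=> c)); last exact: measurable_cst.
    by move=> st; rewrite inE => stA; rewrite mem_set.
  apply: (eq_measurable_fun u) => // st; rewrite inE => stA.
  by rewrite memNset.
split.
- rewrite (_ : (fun _ => _) = fun st => if st \in A then 1 else complex.Re (Q st.1 st.2)).
    exact: aux.
  by apply/funext => st; case: ifP.
- rewrite (_ : (fun _ => _) = fun st => if st \in A then 0 else complex.Im (Q st.1 st.2)).
    exact: aux.
  by apply/funext => st; case: ifP.
Qed.

Lemma Qext_herm (A : set (borel T * borel T)) (Q : T -> T -> R[i]) :
  (forall s t : T, A (s, t) -> A (t, s)) ->
  (forall s t, ~ A (s, t) -> Q s t = (Q t s)^*) ->
  forall z y : phase T R, Qext A Q z y = (Qext A Q y z)^*.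
Proof.
move=> A_sym Q_herm [z a] [y b]; rewrite /Qext/=.
have [zy|zy] := boolP ((z, y) \in A).
  by rewrite mem_set ?rmorph1//; apply: A_sym; move: zy; rewrite inE.
have nA : ~ A (z, y) by move=> /mem_set; exact/negP.
by rewrite memNset; [exact: Q_herm|move=> /A_sym].
Qed.

Lemma Qext_mulC1 (A : set (borel T * borel T)) (Q : T -> T -> R[i]) :
  (forall s t : T, A (s, t) -> A (t, s)) ->
  (forall s t, ~ A (s, t) -> `|Q s t| = 1) ->
  (forall s t, ~ A (s, t) -> Q s t = (Q t s)^*) ->
  forall z y : phase T R, Qext A Q z y * Qext A Q y z = 1.
Proof.
move=> A_sym Q_unit Q_herm z y; rewrite (Qext_herm A_sym Q_herm y z).
apply: mulcJ_normc1; rewrite /Qext; case: ifPn => [_|zy]; first exact: normc1.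
have nA : ~ A (z.1, y.1) by move=> /mem_set; exact/negP.
(* The norm on [R[i]] takes its values in [R[i]]; its real part is [normc]. *)
by have /(congr1 (@complex.Re R)) := Q_unit _ _ nA.
Qed.

End concrete_weight.

Theorem proposition6p6 (R : realType) (T : ptopologicalType)
  (T_polish : polish R T) (T_lc : locally_compact [set: T])
  (sigma : {measure set (borel T) -> \bar R})
  (sigma_radon : radon sigma) (sigma_na : nonatomic sigma)
  (A : set (borel T * borel T)) (mA : measurable A)
  (A_sym : forall s t : T, A (s, t) -> A (t, s))
  (A_diag : forall t : T, A (t, t))
  (A_null : (sigma \x sigma)%E A = 0%E)
  (Q : T -> T -> R[i])
  (mQ : measurable_cfun (~` A) (fun st => Q st.1 st.2))
  (Q_unit : forall s t, ~ A (s, t) -> `|Q s t| = 1)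
  (Q_herm : forall s t, ~ A (s, t) -> Q s t = (Q t s)^*)
  (nu : probability R R)
  (nu_exp : exists2 e : R, 0 < e & (\int[nu]_x (expR (e * `|x|))%:E < +oo)%E)
  (A' B' : set (borel T)) (mA' : measurable A') (mB' : measurable B')
  (AB' : A' `&` B' = set0)
  (m k n : nat) (f : 'I_(m + k) -> T -> R) (g : 'I_n -> T -> R)
  (f_B0 : forall i, B0 (f i)) (g_B0 : forall j, B0 (g j))
  (f_supp : forall i, supp (f i) `<=` A')
  (g_supp : forall j, supp (g j) `<=` B') :
  let mu := prod_measure (radon_measure T_polish T_lc sigma_radon) nu in
  let q := Qext A Q in
  let tau := vacuum_state mu in
  let fs1 := op_prod (fun i => xi mu q (f (lshift k i))) in
  let fs2 := op_prod (fun i => xi mu q (f (rshift m i))) in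
  let gs := op_prod (fun j => xi mu q (g j)) in
  tau (fs1 \o gs \o fs2) = tau (fs1 \o fs2) * tau gs.
Proof.
have [e e0 eoo] := nu_exp.
(* One compact set carries all the test functions, so a single weight serves every field; the Radon
   property makes its measure finite. *)
pose K : set (borel T) := (\big[setU/set0]_(i < m + k) supp (f i)) `|`
  (\big[setU/set0]_(j < n) supp (g j)).
have cK : compact (K : set T).
  apply: compactU; apply: bigsetU_compact => i _.
    by have [] := f_B0 i.
  by have [] := g_B0 i.
have msupp (h : T -> R) : measurable (supp h : set (borel T)).
  rewrite -[supp h]setCK; apply: measurableC; apply: sub_sigma_algebra.
  by apply: closed_openC; exact: closed_closure.
have mK : measurable K.
  by apply: measurableU; apply: bigsetU_measurable => i _; exact: msupp.
have fK i : supp (f i) `<=` K.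
  by move=> t ft; left; rewrite -bigcup_seq; exists i => //=; rewrite mem_index_enum.
have gK j : supp (g j) `<=` K.
  by move=> t gt; right; rewrite -bigcup_seq; exists j => //=; rewrite mem_index_enum.
have [sK _] := sigma_radon.
apply: (@vacuum_factorization _ _ _ _ _ (box_weight K) (Qext_mulC1 A_sym Q_unit Q_herm)
  (Qext_herm A_sym Q_herm) (measurable_Qext mA mQ) (measurable_box_weight mK)
  (@box_weight01 _ _ K) _ [set z | A' z.1] [set z | B' z.1] m k n
  (fun i => xpow (f i) 0) (fun i => xpow (f i) 1)
  (fun j => xpow (g j) 0) (fun j => xpow (g j) 1)).
- move=> N; apply: integrable_box_weight => //; first exact: sK.
  exact: exp_moments_finite eoo N.
- apply/seteqP; split => // z [/= zA zB].
  by have : (A' `&` B') z.1 by []; rewrite AB'.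
- by move=> i; exact: wtest_xpow.
- by move=> i; exact: wtest_xpow.
- by move=> j; exact: wtest_xpow.
- by move=> j; exact: wtest_xpow.
- by move=> i; exact: vanishes_off_xpow.
- by move=> j; exact: vanishes_off_xpow.
- by move=> j; exact: vanishes_off_xpow.
Qed.
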